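(* Let $(Y,Z)$ be a random vector with $Y\in\mathbb{R}^d$, $Z\in\mathbb{R}^k$, and let $X=f(Z)\in\mathbb{R}^p$ be a vector of transformations of $Z$ whose first component equals $1$ and such that conditioning on $X$ is equivalent to conditioning on $Z$; let $\mathcal{X}$ be the support of $X$. Let $F_U$ be a distribution on $\mathbb{R}^d$ with Lebesgue density and convex support $\mathcal{U}$. Assume: (M) $\mathrm{E}\|Y\|^2<\infty$ and $\int\|u\|^2F_U(du)<\infty$; (C) for each $z$ in the support of $Z$, the conditional law of $Y$ given $Z=z$ has a Lebesgue density; (QL) almost surely $Y=\beta(\widetilde U)^\top X$, where $\widetilde U\sim F_U$, $\mathrm{E}(X\mid\widetilde U)=\mathrm{E}(X)$, and $u\mapsto\beta(u)$ maps $\mathcal{U}$ to the set of $p\times d$ real matrices with $\beta(u)^\top x=\nabla_u\Phi_x(u)$, $\Phi_x(u):=B(u)^\top x$, for each $x\in\mathcal{X}$ and a.e. $u\in\mathcal{U}$, where $u\mapsto B(u)$ is a $C^1$ map from $\mathcal{U}$ to $\mathbb{R}^p$ and $u\mapsto B(u)^\top x$ is strictly convex on $\mathcal{U}$ for each $x\in\mathcal{X}$. Then: (i) $\widetilde U$ solves $\max_V\{\mathrm{E}(V^\top Y): V\sim F_U,\ \mathrm{E}(X\mid V)=\mathrm{E}(X)\}$. (ii) The representation is unique a.s.: if also $Y=\overline\beta(\overline U)^\top X$ a.s. with $\overline U\sim F_U$, $\mathrm{E}(X\mid\overline U)=\mathrm{E}(X)$, and $u\mapsto\overline\beta(u)^\top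 X$ is a.s. the gradient of a strictly convex function on $\mathcal{U}$, then $\overline U=\widetilde U$ and $\beta(\widetilde U)^\top X=\overline\beta(\widetilde U)^\top X$ almost surely. (iii) Suppose in addition the linear model (L) holds: $Y=\beta_0(U)^\top X$ a.s. with $U\mid X\sim F_U$ (i.e. $U$ independent of $X$ with law $F_U$), where $u\mapsto\beta_0(u)$ maps $\mathcal{U}$ to $p\times d$ matrices with $\beta_0(u)^\top x=\nabla_u(B_0(u)^\top x)$ for all $(u,x)\in\mathcal{U}\times\mathcal{X}$, $B_0:\mathcal{U}\to\mathbb{R}^p$ of class $C^1$ and $u\mapsto B_0(u)^\top x$ strictly convex; and suppose $\mathrm{E}(XX^\top)$ has full rank. Then $\widetilde U=U$ a.s., $U$ solves the maximization problem in (i), and $\beta_0(U)=\beta(U)$ a.s. *)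

(* Defs.v *)
From HB Require Import structures.
From mathcomp Require Import all_boot all_order all_algebra.
From mathcomp Require Import all_classical all_reals all_analysis.
From mathcomp Require Import measurable_realfun.

Set Implicit Arguments.
Unset Strict Implicit.
Unset Printing Implicit Defensive.

Import Order.TTheory GRing.Theory Num.Theory.
Import numFieldNormedType.Exports.

Local Open Scope classical_set_scope.
Local Open Scope ring_scope.

Notation borelRV R n := (g_sigma_algebraType (@open 'rV[R]_n)).

Definition dotv (R : realType) (n : nat) (u v : 'rV[R]_n) : R :=
  \sum_(i < n) u 0 i * v 0 i.
Definition sqnorm (R : realType) (n : nat) (u : 'rV[R]_n) : R := dotv u u.

Definition box (R : realType) (n : nat) (a b : 'rV[R]_n) : set 'rV[R]_n :=
  [set x | forall i, a 0 i <= x 0 i <= b 0 i].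
Definition boxvol (R : realType) (n : nat) (a b : 'rV[R]_n) : R :=
  \prod_(i < n) Num.max 0 (b 0 i - a 0 i).

Definition lebesgue_null (R : realType) (n : nat) (A : set 'rV[R]_n) : Prop :=
  forall e : R, 0 < e -> exists a b : nat -> 'rV[R]_n,
    A `<=` \bigcup_k box (a k) (b k) /\
    (\sum_(0 <= k <oo) ((boxvol (a k) (b k))%:E) < e%:E)%E.

Definition leb_ae_in (R : realType) (n : nat) (S : set 'rV[R]_n)
    (Q : 'rV[R]_n -> Prop) : Prop :=
  exists N : set 'rV[R]_n, lebesgue_null N /\ forall u, S u -> ~ N u -> Q u.

(** A (probability) measure on R^n has a Lebesgue density, i.e. (Radon-Nikodym)
    it is absolutely continuous w.r.t. Lebesgue measure: it gives mass 0 to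
    every Borel Lebesgue-null set. *)
Definition has_lebesgue_density (R : realType) (n : nat)
    (mu : set (borelRV R n) -> \bar R) : Prop :=
  forall A : set (borelRV R n), measurable A -> lebesgue_null A -> mu A = 0%E.

Definition msupport (R : realType) (n : nat)
    (mu : set (borelRV R n) -> \bar R) : set 'rV[R]_n :=
  [set x | forall A : set 'rV[R]_n, open A -> A x -> (0 < mu A)%E].

Definition rv_support d (Omega : measurableType d) (R : realType) (n : nat)
    (P : probability Omega R) (X : Omega -> 'rV[R]_n) : set 'rV[R]_n :=
  [set x | forall A : set 'rV[R]_n, open A -> A x -> (0 < P (X @^-1` A))%E].

Definition strictly_convex_on (R : realType) (n : nat) (S : set 'rV[R]_n)
    (f : 'rV[R]_n -> R) : Prop :=
  forall u v (t : R), S u -> S v -> u != v -> 0 < t < 1 ->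
    f (t *: u + (1 - t) *: v) < t * f u + (1 - t) * f v.

Definition is_gradient (R : realType) (n : nat) (f : 'rV[R]_n -> R)
    (u g : 'rV[R]_n) : Prop :=
  differentiable f u /\ forall v : 'rV[R]_n, 'd f u v = dotv g v.

(** C^1 on S (S convex, possibly non-open): continuous on S, differentiable
    at every interior point of S with derivative continuous there. *)
Definition C1_on (R : realType) (n m : nat) (S : set 'rV[R]_n)
    (F : 'rV[R]_n -> 'rV[R]_m) : Prop :=
  {within S, continuous F} /\
  (forall u, (S°) u -> differentiable F u) /\
  (forall v : 'rV[R]_n, {within S°, continuous (fun u => 'd F u v)}).

Definition Phi (R : realType) (n p : nat) (B : 'rV[R]_n -> 'rV[R]_p)
    (x : 'rV[R]_p) (u : 'rV[R]_n) : R := dotv (B u) x.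

Definition rand_vec d (Omega : measurableType d) (R : realType) (n : nat)
    (V : Omega -> 'rV[R]_n) : Prop :=
  measurable_fun setT (V : Omega -> borelRV R n).

Definition has_law d (Omega : measurableType d) (R : realType) (n : nat)
    (P : probability Omega R) (V : Omega -> 'rV[R]_n)
    (mu : set (borelRV R n) -> \bar R) : Prop :=
  forall A : set (borelRV R n), measurable A -> P (V @^-1` A) = mu A.

(** E(X | V) = E(X) a.s. (X integrable): for every Borel A,
    E[X 1_{V in A}] = E[X] P(V in A). *)
Definition mean_indep d (Omega : measurableType d) (R : realType) (p n : nat)
    (P : probability Omega R) (X : Omega -> 'rV[R]_p) (V : Omega -> 'rV[R]_n)
    : Prop :=
  (forall i, P.-integrable setT (fun w => (X w 0 i)%:E)) /\
  forall (A : set (borelRV R n)), measurable A -> forall i,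
    (\int[P]_(w in V @^-1` A) (X w 0 i)%:E =
     P (V @^-1` A) * \int[P]_w (X w 0 i)%:E)%E.

Definition indep_rv d (Omega : measurableType d) (R : realType) (n m : nat)
    (P : probability Omega R) (U : Omega -> 'rV[R]_n) (X : Omega -> 'rV[R]_m)
    : Prop :=
  forall (A : set (borelRV R n)) (B : set (borelRV R m)),
    measurable A -> measurable B ->
    P (U @^-1` A `&` X @^-1` B) = (P (U @^-1` A) * P (X @^-1` B))%E.

Definition sigma_sub d (Omega : measurableType d) (R : realType) (k p : nat)
    (Z : Omega -> 'rV[R]_k) (X : Omega -> 'rV[R]_p) : Prop :=
  forall B : set (borelRV R k), measurable B ->
    exists C : set (borelRV R p), measurable C /\ Z @^-1` B = X @^-1` C.

Definition cond_law_has_density d (Omega : measurableType d) (R : realType)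
    (dY k : nat) (P : probability Omega R) (Y : Omega -> 'rV[R]_dY)
    (Z : Omega -> 'rV[R]_k) : Prop :=
  exists kappa : 'rV[R]_k -> probability (borelRV R dY) R,
    (forall A : set (borelRV R dY), measurable A ->
       measurable_fun setT ((fun z => kappa z A) : borelRV R k -> \bar R)) /\
    (forall (A : set (borelRV R dY)) (B : set (borelRV R k)),
       measurable A -> measurable B ->
       P (Y @^-1` A `&` Z @^-1` B) = (\int[P]_(w in Z @^-1` B) kappa (Z w) A)%E) /\
    (forall z, rv_support P Z z -> has_lebesgue_density (kappa z)).

Definition Edot d (Omega : measurableType d) (R : realType) (n : nat)
    (P : probability Omega R) (V Y : Omega -> 'rV[R]_n) : \bar R :=
  (\int[P]_w (dotv (V w) (Y w))%:E)%E.

Definition feasible d (Omega : measurableType d) (R : realType) (n p : nat)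
    (P : probability Omega R) (FU : probability (borelRV R n) R)
    (X : Omega -> 'rV[R]_p) (V : Omega -> 'rV[R]_n) : Prop :=
  rand_vec V /\ has_law P V FU /\ mean_indep P X V.

Definition solves_max d (Omega : measurableType d) (R : realType) (n p : nat)
    (P : probability Omega R) (FU : probability (borelRV R n) R)
    (X : Omega -> 'rV[R]_p) (Y : Omega -> 'rV[R]_n) (U : Omega -> 'rV[R]_n)
    : Prop :=
  feasible P FU X U /\
  forall V, feasible P FU X V -> (Edot P V Y <= Edot P U Y)%E.

(* Main.v *)
Require Import Defs.
From HB Require Import structures.
From mathcomp Require Import all_boot all_order all_algebra.
From mathcomp Require Import all_classical all_reals all_analysis.
From mathcomp Require Import measurable_realfun.
From mathcomp Require Import ring lra.
Import Order.TTheory GRing.Theory Num.Theory.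
Import numFieldNormedType.Exports.
Local Open Scope classical_set_scope.
Local Open Scope ring_scope.

(**
Since [Y] is the gradient of the convex function [B(.).X] at [Ut], one has
[(V - Ut).Y <= B(V).X - B(Ut).X] for every competitor [V]. By mean independence
and equality of laws, both terms on the right have expectation [E(B(U)).E(X)],
so the right-hand side has mean zero. No moment assumption makes [B(V).X]
integrable: the identity is first proved on the sets where [B] is bounded, and
the one-sided integrable bounds provided by the subgradient inequalities allow
passing to the limit. The exceptional Lebesgue-null sets of the gradient
condition depend on [x], but by linearity in [x] a finite family spanning the
support of [X] gives a single one.

For uniqueness, the potentials of a second representation are not assumed to be
linear in [X]. They are replaced by linear combinations of finitely many of them,
which still satisfy the subgradient inequality. Hence both representations are
optimal, the subgradient inequality is an equality at [Ub], and strict convexity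
forces [Ub = Ut].

In the linear model, [D = beta - beta0] satisfies [X D(U) = 0]. For [z] in the
support of [FU], the vector [D(u) (z - u)^T] is a limit of difference quotients
of [B - B0], hence measurable in [u]; by independence and invertibility of
[E(XX^T)] it vanishes at [U]. The support of [FU] lies in no hyperplane, because
hyperplanes are Lebesgue null, so [D(U) = 0].
*)

Set Implicit Arguments.
Unset Strict Implicit.
Unset Printing Implicit Defensive.

(** * Gradients of convex functions *)

(** A free family drawn from [S] of maximal size spans [S], since an element of [S] outside its span
    could be appended to it. This reduces potentials indexed by all [x] to finitely many. *)
Lemma spanning_rows (F : fieldType) (p : nat) (S : set 'rV[F]_p) :
  exists (n : nat) (M : 'M[F]_(n, p)),
    (forall i, S (row i M)) /\ forall x, S x -> (x <= M)%MS.
Proof.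
pose Q n := `[< exists M : 'M[F]_(n, p), row_free M /\ forall i, S (row i M) >].
have exQ : exists n, Q n.
  by exists 0%N; apply/asboolP; exists 0; split=> [|[]//]; rewrite /row_free mxrank0.
have leQ n : Q n -> (n <= p)%N.
  by move=> /asboolP[M [/eqP fM _]]; rewrite -fM rank_leq_col.
have [n /asboolP[M [fM SM]] maxn] := ex_maxnP exQ leQ.
exists n, M; split=> // x Sx; apply: contrapT => /negP xM.
have : Q (n + 1)%N.
  apply/asboolP; exists (col_mx M x); split.
    rewrite /row_free eqn_leq rank_leq_row/= -addsmxE.
    rewrite addn1 -{1}(eqP fM); apply: rank_ltmx.
    by apply/andP; split; [exact: addsmxSl|rewrite addsmx_sub submx_refl].
  move=> i; case: (split_ordP i) => j ->.
    by rewrite rowKu.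
  by rewrite rowKd (_ : row j x = x)//; apply/rowP => k; rewrite mxE ord1.
by move=> /maxn; rewrite addn1 ltnn.
Qed.

Section dotv_lemmas.
Context {R : realType} {n : nat}.
Implicit Types u v w : 'rV[R]_n.

Lemma dotvE u v : dotv u v = (u *m v^T) 0 0.
Proof. by rewrite mxE; apply: eq_bigr => i _; rewrite mxE. Qed.

Lemma dotvC u v : dotv u v = dotv v u.
Proof. by apply: eq_bigr => i _; rewrite mulrC. Qed.

Lemma dotvDr u v w : dotv u (v + w) = dotv u v + dotv u w.
Proof. by rewrite -big_split; apply: eq_bigr => i _; rewrite mxE mulrDr. Qed.

Lemma dotvZr (a : R) u v : dotv u (a *: v) = a * dotv u v.
Proof. by rewrite mulr_sumr; apply: eq_bigr => i _; rewrite mxE mulrCA. Qed.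

Lemma dotvNr u v : dotv u (- v) = - dotv u v.
Proof. by rewrite -scaleN1r dotvZr mulN1r. Qed.

Lemma dotvBr u v w : dotv u (v - w) = dotv u v - dotv u w.
Proof. by rewrite dotvDr dotvNr. Qed.

Lemma dotvBl u v w : dotv (u - v) w = dotv u w - dotv v w.
Proof. by rewrite !(dotvC _ w) dotvBr. Qed.

Lemma dotvZl (a : R) u v : dotv (a *: u) v = a * dotv u v.
Proof. by rewrite dotvC dotvZr dotvC. Qed.

Lemma dotv0r u : dotv u 0 = 0.
Proof. by rewrite -(scale0r 0) dotvZr mul0r. Qed.

Lemma dotv_suml (I : finType) (c : I -> R) (g : I -> 'rV[R]_n) u :
  dotv (\sum_i c i *: g i) u = \sum_i c i * dotv (g i) u.
Proof.
rewrite dotvE mulmx_suml summxE; apply: eq_bigr => i _.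
by rewrite -scalemxAl mxE -dotvE.
Qed.

Lemma coord_le_norm u i : `|u 0 i| <= `|u|.
Proof.
rewrite [leRHS]/Num.norm/= mx_normrE.
by rewrite (bigD1 (0, i))//= le_max lexx.
Qed.

Lemma norm_dotv_le u v : `|dotv u v| <= (\sum_i `|u 0 i|) * `|v|.
Proof.
rewrite mulr_suml (le_trans (ler_norm_sum _ _ _))//.
by apply: ler_sum => i _; rewrite normrM ler_wpM2l ?coord_le_norm.
Qed.

End dotv_lemmas.

Section gradients.
Context {R : realType} {n : nat}.
Implicit Types (f : 'rV[R]_n -> R) (u v g : 'rV[R]_n).

Lemma is_gradient_frechet f u g : is_gradient f u g ->
  forall e : R, 0 < e -> exists2 r : R, 0 < r &
    forall h, `|h| < r -> `|f (u + h) - f u - dotv g h| <= e * `|h|.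
Proof.
move=> [df dfE] e e0.
have := diff_locally df => /eqaddoP/(_ e e0)/nbhs_norm0P[r/= r0 rP].
exists r => // h hr; have := rP h hr.
by rewrite /= !fctE /= [h + u]addrC opprD addrA dfE.
Qed.

Lemma is_gradientD f1 f2 u g1 g2 : is_gradient f1 u g1 -> is_gradient f2 u g2 ->
  is_gradient (f1 \+ f2) u (g1 + g2).
Proof.
move=> [df1 f1E] [df2 f2E]; split; first exact: differentiableD.
by move=> v; rewrite diffD//= f1E f2E !(dotvC _ v) dotvDr.
Qed.

Lemma is_gradientZ (c : R) f u g : is_gradient f u g ->
  is_gradient (fun x => c * f x) u (c *: g).
Proof.
move=> [df fE]; split; first exact: differentiableZ.
by move=> v; rewrite (_ : (fun x => c * f x) = c *: f)// diffZ//= fE dotvZl.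
Qed.

Lemma is_gradient0 u : is_gradient (fun=> 0 : R) u 0.
Proof.
by split=> [|v]; [exact: differentiable_cst|rewrite diff_cst dotvC dotv0r].
Qed.

Lemma is_gradient_sum (I : finType) (c : I -> R) (f : I -> 'rV[R]_n -> R) u
    (g : I -> 'rV[R]_n) : (forall i, is_gradient (f i) u (g i)) ->
  is_gradient (fun x => \sum_i c i * f i x) u (\sum_i c i *: g i).
Proof.
move=> fg; elim: (index_enum I) => [|i r IH].
  rewrite big_nil (_ : (fun=> _) = fun=> 0); first exact: is_gradient0.
  by apply/funext => x; rewrite big_nil.
rewrite big_cons (_ : (fun=> _) = (fun x => c i * f i x) \+
    (fun x => \sum_(j <- r) c j * f j x)).
  by apply: is_gradientD => //; exact: is_gradientZ.
by apply/funext => x; rewrite big_cons.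
Qed.

(** [Phi B x] is linear in [x], so differentiability at the same point [u] passes from the rows of
    [M] to their whole span. One exceptional null set then serves every [x]. *)
Lemma is_gradient_Phi_span (p m : nat) (B : 'rV[R]_n -> 'rV[R]_p)
    (M : 'M[R]_(m, p)) (beta : 'M[R]_(p, n)) u (x : 'rV[R]_p) :
  (forall i, is_gradient (Phi B (row i M)) u (row i M *m beta)) ->
  (x <= M)%MS -> is_gradient (Phi B x) u (x *m beta).
Proof.
move=> gM /submxP[c ->].
have -> : Phi B (c *m M) = fun v => \sum_i c 0 i * Phi B (row i M) v.
  apply/funext => v; rewrite /Phi mulmx_sum_row dotvC dotv_suml.
  by apply: eq_bigr => i _; rewrite dotvC.
rewrite (mulmx_sum_row c M) mulmx_suml.
under eq_bigr do rewrite -scalemxAl.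
exact: is_gradient_sum.
Qed.

Lemma ler_addgt0Mr (a b C : R) : 0 <= C -> (forall e, 0 < e -> a <= b + C * e) -> a <= b.
Proof.
move=> C0 H; apply/ler_addgt0Pl => e e0.
have C1 : 0 < C + 1 by rewrite ltr_wpDl.
have /le_trans := H (e / (C + 1)) (divr_gt0 e0 C1); apply.
rewrite addrC lerD2r mulrCA ger_pMr// ler_pdivrMr// mul1r lerDl//.
Qed.

Lemma convex_setP (S : set 'rV[R]_n) u v (t : R) : convex_set S -> S u -> S v ->
  0 <= t <= 1 -> S (t *: u + (1 - t) *: v).
Proof.
move=> cS Su Sv /andP[t0 t1].
have := cS u v (@Itv01 _ t t0 t1); rewrite !inE => /(_ Su Sv).
by rewrite /conv /=.
Qed.

(** At [u + t *: (v - u)] convexity bounds [f] above by the chord, and differentiability bounds it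
    below by the tangent up to an error [e * t * |v - u|]; then divide by [t]. *)
Lemma is_gradient_le (S : set 'rV[R]_n) f u v g :
  strictly_convex_on S f -> S u -> S v -> is_gradient f u g ->
  f u + dotv g (v - u) <= f v.
Proof.
move=> scf Su Sv /is_gradient_frechet fr.
have [->|uv] := eqVneq v u; first by rewrite subrr dotv0r addr0.
apply: (@ler_addgt0Mr _ _ `|v - u|) => // e e0.
have [r r0 rP] := fr e e0.
have K0 : 0 < `|v - u| by rewrite normr_gt0 subr_eq0.
(* Below 1 for strict convexity, and small enough that the displacement stays within the radius [r]
   of the expansion. *)
pose t := Num.min (2^-1) (r / 2 / `|v - u|).
have t0 : 0 < t by rewrite lt_min invr_gt0 ltr0n/= !divr_gt0.
have t1 : t < 1 by rewrite gt_min; apply/orP; left; lra.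
have htr : `|t *: (v - u)| < r.
  rewrite normrZ gtr0_norm// -ltr_pdivlMr// gt_min; apply/orP; right.
  rewrite ltr_pM2r ?invr_gt0//; lra.
have := scf v u t Sv Su uv; rewrite t0 t1 => /(_ isT).
rewrite (_ : t *: v + (1 - t) *: u = u + t *: (v - u)); last first.
  by rewrite scalerBl scale1r scalerBr addrCA addrC.
move=> cvx; have := rP _ htr; rewrite normrZ (gtr0_norm t0) dotvZr ler_norml => /andP[le1 _].
rewrite -(ler_pM2l t0).
move: cvx le1; set a := f (_ + _); set K := `|_|; set D := dotv _ _ => ? ?.
nra.
Qed.

End gradients.

(** * Riemann sums of subgradients *)

Section riemann.
Context {R : realType}.

Lemma norm_le_invS_eq0 (x K : R) :
  (forall n : nat, `|x| <= K * n.+1%:R^-1) -> x = 0.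
Proof.
move=> xK; apply/eqP; rewrite -normr_le0; apply/ler_addgt0Pr => e e0.
rewrite add0r; have K1 : 0 < `|K| + 1 by rewrite ltr_wpDl.
have [n] := ltr_add_invr (divr_gt0 e0 K1); rewrite add0r ltr_pdivlMr// => nP.
have n0 : 0 <= n.+1%:R^-1 :> R by rewrite invr_ge0.
rewrite (le_trans (xK n))// mulrC; apply: le_trans (ltW nP).
by rewrite ler_wpM2l// (le_trans (ler_norm K))// lerDl.
Qed.

(** Over each cell the increment of [h] lies between the step times [g] at the left end and the step
    times [g] at the right end, so the errors of the left sum telescope. Only grid points have to
    lie in [D], which allows a set of rational parameters. *)
Lemma subgradient_riemann_sum (h g : R -> R) (D : set R) (s : R) (n : nat) :
  0 <= s -> (forall j, (j <= n.+1)%N -> D (s * (j%:R / n.+1%:R))) ->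
  (forall a b, D a -> D b -> h a + g a * (b - a) <= h b) ->
  `|h s - h 0 - \sum_(0 <= j < n.+1) g (s * (j%:R / n.+1%:R)) * (s / n.+1%:R)|
    <= (g s - g 0) * s * n.+1%:R^-1.
Proof.
move=> s0 Dj sub; set dl := s / n.+1%:R; pose x j := s * (j%:R / n.+1%:R) : R.
have dl0 : 0 <= dl by rewrite divr_ge0.
have xn : x n.+1 = s by rewrite /x divff ?mulr1.
have x0 : x 0%N = 0 by rewrite /x mul0r mulr0.
have xS j : x j.+1 - x j = dl by rewrite /x /dl -mulrBr -mulrBl -[j.+1%:R]natr1 [_ + 1 - _]addrC addKr mul1r.
have tele (f : R -> R) : f s - f 0 = \sum_(0 <= j < n.+1) (f (x j.+1) - f (x j)).
  by rewrite (telescope_sumr (fun j => f (x j)))// xn x0.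
rewrite -mulrA -/dl (tele h) (tele g) -sumrB mulr_suml.
have xj j : (j < n.+1)%N ->
    0 <= h (x j.+1) - h (x j) - g (x j) * dl <= (g (x j.+1) - g (x j)) * dl.
  move=> jn; have := sub _ _ (Dj _ (ltnW jn)) (Dj _ jn).
  have := sub _ _ (Dj _ jn) (Dj _ (ltnW jn)).
  rewrite -/(x j) -/(x j.+1) -(opprB (x j.+1)) xS => ? ?; apply/andP; split; lra.
rewrite ger0_norm.
  rewrite big_nat [leRHS]big_nat; apply: ler_sum => j /andP[_ jn].
  by have /andP[] := xj j jn.
by rewrite big_nat; apply: sumr_ge0 => j /andP[_ jn]; have /andP[] := xj j jn.
Qed.

(** On every grid the Riemann sums of the [g i] combine exactly to that of [g0], and each sum is
    within O(1/n) of the increment of its potential. The [c i] may be negative, so the combination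
    of the [h i] is not convex a priori. *)
Lemma subgradient_comb (I : finType) (c : I -> R) (h g : I -> R -> R)
    (h0 g0 : R -> R) (D : set R) (s : R) :
  0 <= s -> (forall n j, (j <= n.+1)%N -> D (s * (j%:R / n.+1%:R))) ->
  (forall i a b, D a -> D b -> h i a + g i a * (b - a) <= h i b) ->
  (forall a b, D a -> D b -> h0 a + g0 a * (b - a) <= h0 b) ->
  (forall a, D a -> \sum_i c i * g i a = g0 a) ->
  \sum_i c i * (h i s - h i 0) = h0 s - h0 0.
Proof.
move=> s0 Dj sub sub0 cg; apply/eqP; rewrite -subr_eq0; apply/eqP.
apply: (@norm_le_invS_eq0 _ ((\sum_i `|c i| * ((g i s - g i 0) * s)) +
  (g0 s - g0 0) * s)) => n.
pose Rs (f : R -> R) := \sum_(0 <= j < n.+1) f (s * (j%:R / n.+1%:R)) * (s / n.+1%:R).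
have RsE : \sum_i c i * Rs (g i) = Rs g0.
  rewrite /Rs; under eq_bigr do rewrite mulr_sumr.
  rewrite exchange_big/= big_nat [RHS]big_nat; apply: eq_bigr => j /andP[_ jn].
  by rewrite -cg ?mulr_suml; [apply: eq_bigr => i _; rewrite mulrA|exact/Dj/ltnW].
rewrite [X in `|X|](_ : _ = \sum_i c i * (h i s - h i 0 - Rs (g i)) -
    (h0 s - h0 0 - Rs g0)); last first.
  by rewrite -RsE; under [in RHS]eq_bigr do rewrite mulrBr; rewrite sumrB; ring.
rewrite mulrDl (le_trans (ler_normB _ _))// lerD//; last first.
  by apply: subgradient_riemann_sum sub0 => // j; exact: Dj.
rewrite (le_trans (ler_norm_sum _ _ _))// mulr_suml; apply: ler_sum => i _.
rewrite normrM -mulrA ler_wpM2l//.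
by apply: subgradient_riemann_sum (sub i) => // j; exact: Dj.
Qed.

End riemann.

(** The endpoints are displaced by order [l ^+ 2] while the intermediate point sits at parameter
    [l]; after division by [l] the displacement vanishes as [l] tends to 0. Convexity inequalities
    on nearby generic segments are therefore enough. *)
Lemma subgradient_of_approx (R : realType) (n : nat) (psi : 'rV[R]_n -> R)
    (u v g : 'rV[R]_n) :
  is_gradient psi u g -> {for v, continuous psi} ->
  (forall l : R, 0 < l < 1 -> (exists m : nat, l = m.+1%:R^-1) ->
     exists2 z, `|z - u| < 1 &
      let u' := u + l ^+ 2 *: (z - u) in let v' := v + l ^+ 2 *: (z - v) in
      psi (u' + l *: (v' - u')) <= (1 - l) * psi u' + l * psi v') ->
  psi u + dotv g (v - u) <= psi v.
Proof.
(* The expansion at [u] towards [v] costs [|v - u| + 1] times [e]; the other four units pay for the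
   expansion at the displaced [u], the continuity at [v], and the terms [t * Gz] and [t * Gv]. *)
move=> gu cv H; apply: (@ler_addgt0Mr _ _ _ (`|v - u| + 5)); first by rewrite addr_ge0.
move=> e e0; have [r r0 rP] := is_gradient_frechet gu e0.
have [r' r'0 r'P] : exists2 r' : R, 0 < r' &
    forall h, `|h| < r' -> `|psi (v + h) - psi v| <= e.
  move/cvgrPdist_le : cv => /(_ e e0)/nbhs_normP[r'/= r'0 r'P].
  exists r' => // h hr'; rewrite distrC; apply: r'P => /=.
  by rewrite opprD addrA subrr add0r normrN.
set K := `|v - u|; set Gv := dotv g (v - u); pose C := \sum_i `|g 0 i|.
have C0 : 0 <= C by exact: sumr_ge0.
have K0 : 0 <= K := normr_ge0 _.
(* [W] dominates [1 + K], [C] and [|Gv|]: the bound [l * W < e'] keeps the displacements within [r]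
   and [r'], the terms in [Gz] and [Gv] below [e], and [l] below 1. *)
pose W := 2 + K + C + `|Gv|.
have W0 : 0 < W by rewrite /W; have := normr_ge0 Gv; lra.
pose e' := Num.min (Num.min r r') (Num.min e 1).
have e'0 : 0 < e' by rewrite !lt_min r0 r'0 e0 ltr01.
have [m] := ltr_add_invr (divr_gt0 e'0 W0); rewrite add0r.
set l := m.+1%:R^-1; rewrite ltr_pdivlMr// => lW.
have l0 : 0 < l by rewrite invr_gt0.
have G0 := normr_ge0 Gv.
have [lr lr' le l1] : [/\ l * W < r, l * W < r', l * W < e & l * W < 1].
  by move: lW; rewrite !lt_min => /andP[/andP[-> ->] /andP[-> ->]].
have l1' : l < 1 by rewrite /W in l1; nra.
have [||z zu /=] := H l; [by rewrite l0|by exists m|].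
set t := l ^+ 2.
have t0 : 0 < t by rewrite exprn_gt0.
have tl : t <= l by rewrite /t expr2; nra.
pose Gz := dotv g (z - u).
have GzC : `|Gz| <= C.
  by rewrite (le_trans (norm_dotv_le _ _))// ler_piMr// ltW.
have zv : `|z - v| <= 1 + K.
  by rewrite -(subrKA u) (le_trans (ler_normD _ _))// lerD ?(ltW zu)// distrC.
set h1 := t *: (z - u); set h2 := t *: (z - v).
have h1t : `|h1| <= t by rewrite /h1 normrZ gtr0_norm// ler_piMr// ltW.
have h2t : `|h2| <= l * (1 + K).
  by rewrite /h2 normrZ gtr0_norm// ler_pM// ltW.
have -> : u + h1 + l *: (v + h2 - (u + h1)) = u + (h1 + (l * (1 - t)) *: (v - u)).
  rewrite -addrA; congr (_ + (_ + _)); rewrite -scalerA; congr (_ *: _).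
  by apply/rowP => i; rewrite !mxE; ring.
set h3 := h1 + _.
have h3l : `|h3| <= l * (1 + K).
  rewrite (le_trans (ler_normD _ _))// [leRHS]mulrDr mulr1 lerD//; first exact: le_trans h1t _.
  rewrite normrZ ger0_norm; last by rewrite mulr_ge0 ?ltW// subr_gt0 (le_lt_trans tl).
  by rewrite -/K ler_wpM2r// ger_pMr//; lra.
have lK : l * (1 + K) <= l * W by rewrite ler_pM2l// /W; lra.
have /rP : `|h3| < r by apply: le_lt_trans lr; exact: le_trans lK.
have /rP : `|h1| < r.
  by apply: le_lt_trans lr; apply: (le_trans h1t); apply: (le_trans tl); rewrite ler_peMr ?ltW// /W; lra.
have /r'P : `|h2| < r' by apply: le_lt_trans lr'; exact: le_trans lK.
have -> : dotv g h1 = t * Gz by rewrite dotvZr.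
have -> : dotv g h3 = t * Gz + l * (1 - t) * Gv by rewrite dotvDr !dotvZr.
have eh1 : e * `|h1| <= e * t by rewrite ler_pM2l.
have eh3 : e * `|h3| <= e * (l * (1 + K)) by rewrite ler_pM2l.
rewrite !ler_norml => /andP[_ q1] /andP[_ q2] /andP[q3 _] q4.
have tGz : - (t * Gz) <= e.
  rewrite (le_trans (ler_norm _))// normrN normrM (gtr0_norm t0).
  by apply: le_trans (ltW le); apply: ler_pM => //; rewrite /W; lra.
have tGv : t * Gv <= e.
  rewrite (le_trans (ler_norm _))// normrM (gtr0_norm t0).
  by apply: le_trans (ltW le); apply: ler_pM => //; rewrite -/Gv /W; lra.
rewrite -(ler_pM2l l0).
have q5 : (1 - l) * psi (u + h1) <= (1 - l) * (psi u + t * Gz + e * t).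
  by apply: ler_wpM2l; lra.
have q6 : l * psi (v + h2) <= l * (psi v + e) by rewrite ler_pM2l//; lra.
have q7 : l * (t * Gv) <= l * e by rewrite ler_pM2l.
have q8 : l * - (t * Gz) <= l * e by rewrite ler_pM2l.
have q9 : (1 - l) * (e * t) <= l * e.
  rewrite mulrCA [leRHS]mulrC ler_pM2l//; apply: le_trans tl.
  by rewrite ger_pMl//; lra.
lra.
Qed.

(** * Lebesgue-null sets and supports *)

Section borel.
Context {R : realType} {n : nat}.
Implicit Types A : set 'rV[R]_n.

Lemma open_borel A : open A -> measurable (A : set (borelRV R n)).
Proof. by move=> oA; apply: sub_sigma_algebra. Qed.

Lemma closed_borel A : closed A -> measurable (A : set (borelRV R n)).
Proof.
by move=> /closed_openC/open_borel/measurableC; rewrite setCK.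
Qed.

Lemma box_borel (a b : 'rV[R]_n) : measurable (box a b : set (borelRV R n)).
Proof.
apply: closed_borel.
have -> : box a b = \bigcap_(i in [set: 'I_n]) [set x | a 0 i <= x 0 i <= b 0 i].
  by apply/seteqP; split=> x H i; [move=> _; exact: H|exact: H].
apply: closed_bigI => i _.
rewrite [X in closed X](_ : _ = (fun x : 'rV[R]_n => x 0 i) @^-1` `[a 0 i, b 0 i]%classic).
  apply: preimage_closed; last exact: itv_closed.
  by move=> x _; exact: coord_continuous.
by apply/seteqP; split=> x /=; rewrite in_itv.
Qed.

Lemma within_continuous_borel (G : set 'rV[R]_n) (f : 'rV[R]_n -> R) :
  measurable (G : set (borelRV R n)) -> {within G, continuous f} ->
  measurable_fun (G : set (borelRV R n)) (f : borelRV R n -> R).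
Proof.
move=> mG /continuousP cf; apply: (measurability _ (RGenOInfty.measurableE R)).
move=> _ [_ [x ->] <-].
have /cf/open_subspaceP[V oV VG] : open `]x, +oo[%classic by exact: interval_open.
by rewrite setIC -VG; apply: measurableI => //; exact: open_borel.
Qed.

Lemma coord_borel i : measurable_fun setT (fun u : borelRV R n => u 0 i : R).
Proof.
apply: within_continuous_borel => //.
by apply: continuous_subspaceT => x; exact: coord_continuous.
Qed.

Lemma boxvol_ge0 (a b : 'rV[R]_n) : 0 <= boxvol a b.
Proof. by apply: prodr_ge0 => i _; rewrite le_max lexx. Qed.

(** The inverse affine map divides box volumes by [t ^+ n], so a cover of [A] of total volume below
    [t ^+ n * e] is pulled back. *)
Lemma lebesgue_null_affine A (c : 'rV[R]_n) (t : R) : 0 < t -> lebesgue_null A ->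
  lebesgue_null [set z | A (c + t *: z)].
Proof.
move=> t0 nA e e0; have t0' := lt0r_neq0 t0.
have tn : 0 < t ^+ n by exact: exprn_gt0.
have [a [b [Aab sab]]] := nA (t ^+ n * e) (mulr_gt0 tn e0).
exists (fun k => t^-1 *: (a k - c)), (fun k => t^-1 *: (b k - c)); split.
  move=> z /Aab[k _ abk]; exists k => // i; move: (abk i); rewrite !mxE.
  rewrite ![t^-1 * _]mulrC ler_pdivrMr// ler_pdivlMr// [_ * t]mulrC.
  by rewrite lerBlDl lerBrDl.
have volE k : boxvol (t^-1 *: (a k - c)) (t^-1 *: (b k - c)) =
    (t ^+ n)^-1 * boxvol (a k) (b k).
  rewrite /boxvol -exprVn -[X in _ ^+ X](card_ord n) -prodr_const -big_split/=.
  apply: eq_bigr => i _; rewrite !mxE -mulrBr opprB addrA subrK.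
  by rewrite maxr_pMr ?mulr0// invr_ge0 ltW.
under eq_eseriesr do rewrite volE EFinM.
rewrite nneseriesZl; last by move=> k _; rewrite lee_fin boxvol_ge0.
rewrite muleC -lte_pdivlMr ?invr_gt0// invrK -EFinM.
by rewrite [e * _]mulrC.
Qed.

(** [A] may fail to be Borel, whereas [has_lebesgue_density] speaks of Borel sets. Intersecting over
    [m] box covers of total volume below [1/(m+1)] gives a Borel null set containing [A]. *)
Lemma null_negligible (mu : probability (borelRV R n) R) A :
  has_lebesgue_density mu -> lebesgue_null A -> mu.-negligible A.
Proof.
move=> dmu nA.
have ? : forall m : nat, 0 < m.+1%:R^-1 :> R by move=> m; rewrite invr_gt0.
have /choice[ab abP] : forall m : nat, exists ab : nat -> 'rV[R]_n * 'rV[R]_n,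
    A `<=` \bigcup_k box (ab k).1 (ab k).2 /\
    (\sum_(0 <= k <oo) ((boxvol (ab k).1 (ab k).2)%:E) < (m.+1%:R^-1)%:E)%E.
  move=> m; have [//|a [b H]] := nA m.+1%:R^-1.
  by exists (fun k => (a k, b k)).
pose C := \bigcap_m \bigcup_k box (ab m k).1 (ab m k).2.
have mC : measurable (C : set (borelRV R n)).
  apply: bigcapT_measurable => m; apply: bigcupT_measurable => k; exact: box_borel.
exists C; split => //; last by move=> x Ax m _; exact: (abP m).1.
apply: dmu => // e e0; have [m] := ltr_add_invr e0; rewrite add0r => me.
exists (fun k => (ab m k).1), (fun k => (ab m k).2); split.
  by move=> x /(_ m I).
by apply: lt_trans (abP m).2 _; rewrite lte_fin.
Qed.

(** Lindelof argument: every point outside the support lies in one of the countably many null balls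
    with rational centre and radius [1/(m+1)]. *)
Lemma msupport_compl_negligible (mu : {measure set (borelRV R n) -> \bar R}) :
  mu.-negligible (~` msupport mu).
Proof.
pose b (x : 'rV[rat]_n * nat) : set 'rV[R]_n :=
  ball (map_mx ratr x.1 : 'rV[R]_n) x.2.+1%:R^-1.
have bo x : open (b x) by exact: ball_open.
pose F k : set (borelRV R n) := if unpickle k is Some x
  then if mu (b x) == 0%E then b x else set0 else set0.
have : mu.-negligible (\bigcup_k F k).
  apply: negligible_bigcup => k; rewrite /F; case: unpickle => [x|]; last exact: negligible_set0.
  case: ifPn => [/eqP m0|_]; last exact: negligible_set0.
  by apply/negligibleP => //; exact: (open_borel (bo x)).
apply: negligibleS => x /=.
move=> /existsNP[A] /not_implyP[oA] /not_implyP[Ax] /negP muA.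
have [e /= e0 eA] : exists2 e : R, 0 < e & ball x e `<=` A.
  by move: oA; rewrite openE => /(_ x Ax) /nbhs_ballP[e e0 eA]; exists e.
(* With a radius below [e / 2], a ball that contains [x] stays inside [ball x e]. *)
have [m me] := ltr_add_invr (divr_gt0 e0 (@ltr0Sn R 1)); rewrite add0r in me.
have m0 : 0 < m.+1%:R^-1 :> R by rewrite invr_gt0.
have /choice[q qP] : forall i, exists q : rat, ratr q \in `]x 0 i - m.+1%:R^-1, x 0 i + m.+1%:R^-1[.
  by move=> i; apply: rat_in_itvoo; rewrite ltrBlDr -addrA ltrDl addr_gt0.
pose y : 'rV[rat]_n := \row_i q i.
have xy : ball (map_mx ratr y : 'rV[R]_n) m.+1%:R^-1 x.
  split=> // i j; rewrite !mxE (ord1 i) /ball /= /ball_ /=; move: (qP j).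
  by rewrite in_itv /= ltr_distl.
exists (pickle (y, m)) => //; rewrite /F pickleK.
suff -> : mu (b (y, m)) == 0%E by [].
have bA : b (y, m) `<=` A.
  apply: subset_trans eA => z bz; apply: (@le_ball _ _ _ (m.+1%:R^-1 + m.+1%:R^-1) e).
    by rewrite -mulr2n -[leLHS]mulr_natr -ler_pdivlMr// ltW.
  by apply: ball_triangle bz; exact: ball_sym.
rewrite eq_le measure_ge0 andbT; apply: (@le_trans _ _ (mu A)).
  by apply: le_measure; rewrite ?inE//; exact: open_borel.
by rewrite leNgt.
Qed.

Lemma closed_msupport (mu : {measure set (borelRV R n) -> \bar R}) :
  closed (msupport mu).
Proof.
rewrite -openC.
have openI (S : set 'rV[R]_n) : (forall x, S x -> nbhs x S) -> open S by rewrite openE.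
apply: openI => x /existsNP[A] /not_implyP[oA] /not_implyP[Ax] muA.
apply: filterS (open_nbhs_nbhs (conj oA Ax)) => y Ay /(_ A oA Ay); exact.
Qed.

End borel.

Lemma negligible_bigcup_countable d (T : sigmaRingType d) (R : realFieldType)
    (mu : {measure set T -> \bar R}) (I : countType) (F : I -> set T) :
  (forall i, mu.-negligible (F i)) -> mu.-negligible (\bigcup_i F i).
Proof.
move=> nF; pose G k := if unpickle k is Some i then F i else set0.
apply: (@negligibleS _ _ _ _ (\bigcup_k G k)).
  by move=> x [i _ Fix]; exists (pickle i) => //; rewrite /G pickleK.
by apply: negligible_bigcup => k; rewrite /G; case: unpickle => // *; exact: negligible_set0.
Qed.

(** A neighbourhood of a support point has positive mass, so [N] and the complement of the support
    cannot cover it. This supplies generic points of the support. *)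
Lemma msupport_pick (R : realType) (n : nat) (mu : probability (borelRV R n) R)
    (A N : set 'rV[R]_n) u : msupport mu u -> open A -> A u -> mu.-negligible N ->
  exists z, [/\ A z, msupport mu z & ~ N z].
Proof.
move=> su oA Au nN; apply: contrapT => nex.
have : mu.-negligible A.
  apply: negligibleS (negligibleU nN (msupport_compl_negligible mu)) => z Az.
  by apply: contrapT => /not_orP[Nz /contrapT sz]; apply: nex; exists z.
move/(negligibleP _ (open_borel oA)) => A0.
by have := su A oA Au; rewrite A0 ltxx.
Qed.

(* The points [u] and [v] are pulled towards a generic point [z] of the support,
   so that all rational points of the new segment avoid the exceptional null
   sets; there the combination of the [phi i] and [phi0] have the same Riemann
   sums, hence the same increments. *)
Lemma comb_subgradient (R : realType) (d p m : nat)
    (FU : probability (borelRV R d) R) (M : 'M[R]_(m, p))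
    (beta : 'rV[R]_d -> 'M[R]_(p, d)) (phi : 'I_m -> 'rV[R]_d -> R)
    (c : 'rV[R]_m) (phi0 : 'rV[R]_d -> R) (u v : 'rV[R]_d) :
  has_lebesgue_density FU -> convex_set (msupport FU) ->
  (forall i, strictly_convex_on (msupport FU) (phi i)) ->
  (forall i, leb_ae_in (msupport FU)
    (fun u => is_gradient (phi i) u (row i M *m beta u))) ->
  strictly_convex_on (msupport FU) phi0 ->
  leb_ae_in (msupport FU) (fun u => is_gradient phi0 u (c *m M *m beta u)) ->
  msupport FU u -> msupport FU v ->
  (forall i, is_gradient (phi i) u (row i M *m beta u)) ->
  (forall i, is_gradient (phi i) v (row i M *m beta v)) ->
  \sum_i c 0 i * phi i u + dotv (c *m M *m beta u) (v - u) <=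
  \sum_i c 0 i * phi i v.
Proof.
move=> dFU cU scphi gphi scphi0 [N0 [nN0 gN0]] Uu Uv gu gv.
have betaE w : c *m M *m beta w = \sum_i c 0 i *: (row i M *m beta w).
  rewrite (mulmx_sum_row c M) mulmx_suml.
  by apply: eq_bigr => i _; rewrite scalemxAl.
have gpsi w : (forall i, is_gradient (phi i) w (row i M *m beta w)) ->
    is_gradient (fun x => \sum_i c 0 i * phi i x) w (c *m M *m beta w).
  by move=> gw; rewrite betaE; exact: is_gradient_sum.
apply: (@subgradient_of_approx _ _ (fun x => \sum_i c 0 i * phi i x) u v).
- exact: gpsi.
- by apply: differentiable_continuous; have [] := gpsi v gv.
move=> l /andP[l0 l1] [k lE].
pose t := l ^+ 2.
have t0 : 0 < t by rewrite exprn_gt0.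
have t1 : t < 1 by rewrite /t expr2; nra.
have /choice[N NP] := gphi.
pose pt (s : R) z := (1 - t) *: (u + s *: (v - u)) + t *: z.
(* For fixed [s], [pt s z] is affine in [z] with ratio [t > 0], so the [z] that it sends into a null
   set form a null set. *)
have nbad (A : set 'rV[R]_d) : lebesgue_null A ->
    FU.-negligible (\bigcup_(q : rat) [set z | A (pt (ratr q) z)]).
  move=> nA; apply: negligible_bigcup_countable => q.
  by apply: null_negligible => //; exact: lebesgue_null_affine.
have nN : FU.-negligible ((\bigcup_(q : rat) [set z | N0 (pt (ratr q) z)]) `|`
    \bigcup_(i : 'I_m) (\bigcup_(q : rat) [set z | N i (pt (ratr q) z)])).
  apply: negligibleU; first exact: nbad.
  by apply: negligible_bigcup_countable => i; apply: nbad; have [] := NP i.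
have [||z [zu Uz /not_orP[z0 zN]]] := @msupport_pick _ _ _ (ball u 1) _ u Uu _ _ nN.
- exact: ball_open.
- exact: ballxx.
exists z; first by move: zu; rewrite -ball_normE /= distrC.
move=> u' v'.
have ptE s : u' + s *: (v' - u') = pt s z.
  by apply/rowP => i; rewrite /u' /v' /pt /t !mxE; ring.
have Upt s : 0 <= s <= 1 -> msupport FU (pt s z).
  move=> s01; have Us : msupport FU (u + s *: (v - u)).
    have := convex_setP cU Uv Uu s01.
    by rewrite (_ : s *: v + _ = u + s *: (v - u))//; apply/rowP => i; rewrite !mxE; ring.
  have := convex_setP cU Uz Us (t := t); rewrite ltW//= ltW// => /(_ isT).
  by rewrite addrC.
(* Countably many parameters, so that a single [z] avoids all exceptional sets. They contain the
   grids of every rational endpoint, in particular of [l], which is the inverse of an integer. *)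
pose D : set R := [set s | 0 <= s <= 1 /\ exists q : rat, s = ratr q].
have ptB a b : pt b z - pt a z = (b - a) *: (v' - u').
  by apply/rowP => i; rewrite /u' /v' /pt /t !mxE; ring.
have sub (f : 'rV[R]_d -> R) (g : 'rV[R]_d -> 'rV[R]_d) :
    strictly_convex_on (msupport FU) f ->
    (forall s, D s -> is_gradient f (pt s z) (g (pt s z))) ->
    forall a b, D a -> D b ->
      f (pt a z) + dotv (g (pt a z)) (v' - u') * (b - a) <= f (pt b z).
  move=> scf gf a b Da Db; rewrite mulrC -dotvZr -ptB.
  by apply: is_gradient_le scf _ _ (gf a Da); apply: Upt; [exact: Da.1|exact: Db.1].
have sub0 := sub _ (fun w => c *m M *m beta w) scphi0.
have subi i := sub _ (fun w => row i M *m beta w) (scphi i).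
have {}sub0 : forall a b, D a -> D b -> phi0 (pt a z) +
    dotv (c *m M *m beta (pt a z)) (v' - u') * (b - a) <= phi0 (pt b z).
  apply: sub0 => s [s01 [q sE]]; apply: gN0; first exact: Upt.
  by move=> ?; apply: z0; exists q; rewrite //= -sE.
have {}subi i : forall a b, D a -> D b -> phi i (pt a z) +
    dotv (row i M *m beta (pt a z)) (v' - u') * (b - a) <= phi i (pt b z).
  apply: subi => s [s01 [q sE]]; apply: (NP i).2; first exact: Upt.
  by move=> ?; apply: zN; exists i => //; exists q; rewrite //= -sE.
have Dl : D l.
  by split; [rewrite !ltW|exists (k.+1%:R^-1); rewrite fmorphV/= ratr_nat].
have D0 : D 0 by split; [rewrite lexx ler01|exists 0; rewrite rmorph0].
have D1 : D 1 by split; [rewrite lexx ler01|exists 1; rewrite rmorph1].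
have comb s : D s -> \sum_i c 0 i * (phi i (pt s z) - phi i (pt 0 z)) =
    phi0 (pt s z) - phi0 (pt 0 z).
  move=> [/andP[s0 s1] [q sE]].
  apply: (@subgradient_comb _ _ (fun i => c 0 i) (fun i s => phi i (pt s z))
    (fun i s => dotv (row i M *m beta (pt s z)) (v' - u')) (fun s => phi0 (pt s z))
    (fun s => dotv (c *m M *m beta (pt s z)) (v' - u')) D) => //.
  - move=> n j jn; split.
      have j1 : j%:R / n.+1%:R <= 1 :> R by rewrite ler_pdivrMr ?mul1r ?ler_nat.
      rewrite mulr_ge0 ?divr_ge0//=; apply: le_trans s1.
      by rewrite ler_piMr.
    by exists (q * (j%:R / n.+1%:R)); rewrite !rmorphM/= fmorphV/= !ratr_nat sE.
  - by move=> a Da; rewrite betaE dotv_suml.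
(* The combination has the same increments as [phi0] from parameter 0 to [l] and to 1. For [phi0],
   the subgradient inequalities at [l] towards 0 and 1, weighted by [1 - l] and [l], cancel the
   gradient and give convexity. *)
have := comb l Dl; have := comb 1 D1.
under eq_bigr do rewrite mulrBr.
under [in X in _ -> X -> _]eq_bigr do rewrite mulrBr.
rewrite !sumrB -!ptE scale0r addr0 scale1r addrCA subrr addr0 => e1 el.
have := sub0 l 0 Dl D0; have := sub0 l 1 Dl D1.
rewrite -!ptE scale0r addr0 scale1r [u' + (v' - u')]addrCA subrr addr0.
move: e1 el; set S1 := \sum_i _ in |- *; set a0 := phi0 _; set al := phi0 _.
nra.
Qed.

(** * Expectations and mean independence *)

Section expectation.
Context {dO : measure_display} {Omega : measurableType dO} {R : realType}.
Variable P : probability Omega R.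
Implicit Types f g h W : Omega -> R.

Local Notation L1 f := (P.-integrable setT (EFin \o f)).
Local Notation Ex f := (\int[P]_w f w)%R.

Lemma L1_measurable f : L1 f -> measurable_fun setT f.
Proof. by move=> /measurable_int/measurable_EFinP. Qed.

Lemma L1_le f g : measurable_fun setT f -> (forall w, `|f w| <= g w) -> L1 g -> L1 f.
Proof.
move=> mf fg; apply: le_integrable => //; first exact/measurable_EFinP.
by move=> w _ /=; rewrite lee_fin (le_trans (fg w))// ler_norm.
Qed.

Lemma L1D f g : L1 f -> L1 g -> L1 (fun w => f w + g w).
Proof. by move=> lf lg; have := integrableD measurableT lf lg. Qed.

Lemma L1Z (c : R) f : L1 f -> L1 (fun w => c * f w).
Proof. by move=> lf; have := integrableZl measurableT c lf. Qed.

Lemma L1N f : L1 f -> L1 (fun w => - f w).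
Proof. by move=> /integrableN. Qed.

Lemma L1B f g : L1 f -> L1 g -> L1 (fun w => f w - g w).
Proof. by move=> lf lg; apply: L1D => //; exact: L1N. Qed.

Lemma L1_norm f : L1 f -> L1 (fun w => `|f w|).
Proof. by move=> /integrable_abse. Qed.

Lemma L1_cst (c : R) : L1 (fun=> c).
Proof. exact: finite_measure_integrable_cst. Qed.

Lemma L1_sum (I : Type) (r : seq I) (f : I -> Omega -> R) :
  (forall i, L1 (f i)) -> L1 (fun w => \sum_(i <- r) f i w).
Proof.
move=> lf; elim: r => [|i r IH].
  by under eq_fun do rewrite big_nil; exact: (L1_cst 0).
by under eq_fun do rewrite big_cons; apply: L1D.
Qed.

Lemma ExD f g : L1 f -> L1 g -> Ex (fun w => f w + g w) = Ex f + Ex g.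
Proof. exact: RintegralD. Qed.

Lemma ExB f g : L1 f -> L1 g -> Ex (fun w => f w - g w) = Ex f - Ex g.
Proof. exact: RintegralB. Qed.

Lemma ExZ (c : R) f : L1 f -> Ex (fun w => c * f w) = c * Ex f.
Proof. exact: RintegralZl. Qed.

Lemma Ex_cst (c : R) : Ex (fun=> c) = c.
Proof. by rewrite Rintegral_cst//= probability_setT /= mulr1. Qed.

Lemma Ex_sum (I : Type) (r : seq I) (f : I -> Omega -> R) :
  (forall i, L1 (f i)) -> Ex (fun w => \sum_(i <- r) f i w) = \sum_(i <- r) Ex (f i).
Proof.
move=> lf; elim: r => [|i r IH].
  by under eq_Rintegral do rewrite big_nil; rewrite big_nil Ex_cst.
by under eq_Rintegral do rewrite big_cons; rewrite big_cons ExD ?IH//; exact: L1_sum.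
Qed.

Lemma Ex_ae f g : measurable_fun setT f -> measurable_fun setT g ->
  {ae P, forall w, f w = g w} -> Ex f = Ex g.
Proof.
move=> mf mg fg; rewrite /Rintegral; congr fine; apply: ae_eq_integral => //.
- exact/measurable_EFinP.
- exact/measurable_EFinP.
- by apply: filterS fg => w fgw _; rewrite fgw.
Qed.

(** Replacing [f] by the minimum of [f] and [g], which equals [f] almost surely, makes the
    inequality hold everywhere. *)
Lemma Ex_le_ae f g : L1 f -> L1 g -> {ae P, forall w, f w <= g w} -> Ex f <= Ex g.
Proof.
move=> lf lg fg.
have -> : Ex f = Ex (fun w => Num.min (f w) (g w)).
  apply: Ex_ae; first exact: L1_measurable.
    by apply: measurable_minr; exact: L1_measurable.
  by apply: filterS fg => w; rewrite minEle => ->.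
apply: le_Rintegral => //.
  apply: (@L1_le _ (fun w => `|f w| + `|g w|)).
  - by apply: measurable_minr; exact: L1_measurable.
  - move=> w; rewrite minEle; case: ifP => _; first by rewrite lerDl.
    by rewrite lerDr.
  - by apply: L1D; exact: L1_norm.
by move=> w _; rewrite ge_min lexx orbT.
Qed.

Lemma Ex_dominated (f_ : nat -> Omega -> R) f g :
  (forall n, measurable_fun setT (f_ n)) -> measurable_fun setT f ->
  (forall w, f_ n w @[n --> \oo] --> f w) ->
  (forall n w, `|f_ n w| <= g w) -> L1 g ->
  Ex (f_ n) @[n --> \oo] --> Ex f.
Proof.
move=> mf_ mf cf fg lg.
have [] := @dominated_convergence _ _ _ P setT measurableT
  (fun n => EFin \o f_ n) (EFin \o f) (EFin \o g).
- by move=> n; exact/measurable_EFinP.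
- exact/measurable_EFinP.
- by apply: aeW => w _; apply: cvg_EFin; [exact: nearW|exact: cf].
- exact: lg.
- by apply: aeW => w n _ /=; rewrite lee_fin.
move=> lf _ cvg; apply: fine_cvg.
by rewrite fineK//; exact: integrable_fin_num.
Qed.

Lemma Ex_ge0_eq0_ae f : L1 f -> {ae P, forall w, 0 <= f w} -> Ex f = 0 ->
  {ae P, forall w, f w = 0}.
Proof.
move=> lf f0 Ef0; have mf := L1_measurable lf.
have Eabs : Ex (fun w => `|f w|) = 0.
  rewrite -Ef0; apply: Ex_ae => //; first exact: measurableT_comp.
  by apply: filterS f0 => w; exact: ger0_norm.
have : (\int[P]_w `|(f w)%:E| = 0)%E.
  have /integrable_fin_num := L1_norm lf => /(_ measurableT)/fineK <-.
  by rewrite [fine _]Eabs.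
move/ae_eq_integral_abs => /(_ measurableT).
have /measurable_EFinP mf' := mf.
by move=> /(_ mf'); apply: filterS => w /(_ I)[].
Qed.

(** Monotone convergence, applied to [|f|] cut off on [E n]. It yields integrability when only
    truncated expectations are under control. *)
Lemma L1_exhaust f (E : nat -> set Omega) (K : R) :
  measurable_fun setT f -> (forall n, measurable (E n)) ->
  {homo E : m n / (m <= n)%N >-> (m `<=` n)} -> (forall w, exists n, E n w) ->
  (forall n, L1 (fun w => `|f w| * \1_(E n) w) /\
     Ex (fun w => `|f w| * \1_(E n) w) <= K) -> L1 f.
Proof.
move=> mf mE ndE covE fK; apply/integrableP; split; first exact/measurable_EFinP.
pose g n w := (`|f w| * \1_(E n) w)%:E : \bar R.
have cg w : g^~ w @ \oo --> `|(f w)%:E|%E.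
  apply: cvg_near_cst; have [n En] := covE w; exists n => // m /= nm.
  by rewrite /g /= indicE mem_set ?mulr1//; exact: ndE nm _ En.
have := @cvg_monotone_convergence _ _ _ P setT measurableT g.
have -> : (fun x => limn (g^~ x)) = (fun x => `|(f x)%:E|%E).
  by apply/funext => w; apply/cvg_lim => //; exact: cg.
move=> /(_ _ _ _)/cvg_lim <- //; last 3 first.
- move=> n; apply/measurable_EFinP; apply: measurable_funM.
    exact: measurableT_comp.
  exact: measurable_indic.
- by move=> n w _; rewrite lee_fin mulr_ge0.
- move=> w _ m n mn; rewrite lee_fin ler_wpM2l// !indicE ler_nat.
  case: (boolP (w \in E m)) => //; rewrite inE => Em.
  by rewrite mem_set//; exact: ndE mn _ Em.
apply: (@le_lt_trans _ _ K%:E); last exact: ltry.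
apply: lime_le.
  apply: ereal_nondecreasing_is_cvgn => m n mn; apply: ge0_le_integral => //.
  - by move=> w _; rewrite lee_fin mulr_ge0.
  - by apply/measurable_EFinP; apply: L1_measurable; exact: (fK m).1.
  - by apply/measurable_EFinP; apply: L1_measurable; exact: (fK n).1.
  - move=> w _; rewrite lee_fin ler_wpM2l// !indicE ler_nat.
    case: (boolP (w \in E m)) => //; rewrite inE => Em.
    by rewrite mem_set//; exact: ndE mn _ Em.
apply: nearW => n; have [lf le] := fK n.
by rewrite -(fineK (integrable_fin_num measurableT lf)) lee_fin.
Qed.

End expectation.

Section mean_independence.
Import HBNNSimple.
Context {dO dT : measure_display} {Omega : measurableType dO}
  {T : measurableType dT} {R : realType}.
Variable P : probability Omega R.
Variable V : Omega -> T.
Hypothesis mV : measurable_fun setT V.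
Implicit Types W : Omega -> R.

Local Notation L1 f := (P.-integrable setT (EFin \o f)).
Local Notation Ex f := (\int[P]_w f w)%R.

(** The condition E(W | V) = E(W), tested on indicators. Integrability of [W] is assumed separately,
    because the real-valued integral is total. *)
Definition mean_indep_of W := forall A : set T, measurable A ->
  Ex (fun w => W w * \1_A (V w)) = Ex W * Ex (fun w => \1_A (V w)).

Let mphi (phi : T -> R) : measurable_fun setT phi ->
  measurable_fun setT (fun w => phi (V w)).
Proof. by move=> mp; exact: measurableT_comp mp mV. Qed.

Lemma L1_bounded W (phi : T -> R) (K : R) : L1 W -> measurable_fun setT phi ->
  (forall x, `|phi x| <= K) -> L1 (fun w => W w * phi (V w)).
Proof.
move=> lW mp pK; apply: (@L1_le _ _ _ _ _ (fun w => K * `|W w|)).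
- by apply: measurable_funM; [exact: L1_measurable lW|exact: mphi].
- by move=> w; rewrite normrM mulrC ler_wpM2r.
- by apply: L1Z; exact: L1_norm.
Qed.

Lemma L1_bounded_comp (phi : T -> R) (K : R) : measurable_fun setT phi ->
  (forall x, `|phi x| <= K) -> L1 (fun w => phi (V w)).
Proof.
move=> mp pK; have := L1_bounded (L1_cst P 1) mp pK.
by under eq_fun do rewrite mul1r.
Qed.

Lemma mean_indep_sfun W (s : {nnsfun T >-> R}) : L1 W -> mean_indep_of W ->
  Ex (fun w => W w * s (V w)) = Ex W * Ex (fun w => s (V w)).
Proof.
move=> lW mW; pose r := finmap.enum_fset (fset_set (range s)).
have sE x : s x = \sum_(y <- r) y * \1_(s @^-1` [set y]) x.
  by rewrite {1}(fimfunE s) fsbig_finite.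
have mA y : measurable (s @^-1` [set y]) by exact: measurable_sfunP.
have m1 y : measurable_fun setT (\1_(s @^-1` [set y]) : T -> R) by exact: measurable_indic.
have l1 y : L1 (fun w => \1_(s @^-1` [set y]) (V w) : R).
  by apply: (L1_bounded_comp (K := 1)) => // x; rewrite indicE; case: (_ \in _); rewrite ?normr1 ?normr0.
have lW1 y : L1 (fun w => W w * \1_(s @^-1` [set y]) (V w)).
  by apply: (L1_bounded (K := 1)) => // x; rewrite indicE; case: (_ \in _); rewrite ?normr1 ?normr0.
under eq_Rintegral do rewrite sE mulr_sumr.
under [X in _ = _ * X]eq_Rintegral do rewrite sE.
rewrite !Ex_sum; [|by move=> y; exact: L1Z|]; last first.
  by move=> y; under eq_fun do rewrite mulrCA; exact: L1Z.
rewrite mulr_sumr; apply: eq_bigr => y _.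
under eq_Rintegral do rewrite mulrCA.
by rewrite !ExZ// mW// mulrCA.
Qed.

(** Boundedness of [phi] dominates the approximations of W phi(V) by [K * |W|], so the identity
    passes from simple functions to the limit. *)
Lemma mean_indep_bounded W (phi : T -> R) (K : R) : L1 W -> mean_indep_of W ->
  measurable_fun setT phi -> (forall x, `|phi x| <= K) ->
  Ex (fun w => W w * phi (V w)) = Ex W * Ex (fun w => phi (V w)).
Proof.
(* Adding [K] makes [phi] nonnegative and changes both sides by [K * Ex W]. *)
move=> lW mW; wlog p0 : phi K / forall x, 0 <= phi x.
  move=> H mp pK.
  have mpK : measurable_fun setT (fun x => phi x + K).
    by apply: measurable_funD => //; exact: measurable_cst.
  have pK2 x : `|phi x + K| <= K + K.
    by rewrite (le_trans (ler_normD _ _))// lerD// ger0_norm// (le_trans _ (pK x)).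
  have := H _ (K + K) _ mpK pK2.
  have lp : L1 (fun w => phi (V w)) by exact: L1_bounded_comp pK.
  have lWp : L1 (fun w => W w * phi (V w)) by exact: L1_bounded pK.
  have lK : L1 (fun=> K) by exact: L1_cst.
  have lWK : L1 (fun w => K * W w) by exact: L1Z.
  under eq_Rintegral do rewrite mulrDr (mulrC _ K).
  rewrite ExD// ExD// ExZ// Ex_cst mulrDr (mulrC _ K) => /(_ _)/addIr; apply.
  by move=> x; have := pK x; rewrite ler_norml; lra.
move=> mp pK.
have mEp : measurable_fun setT (EFin \o phi) by exact/measurable_EFinP.
pose s := nnsfun_approx measurableT mEp.
have sle n x : s n x <= phi x.
  rewrite -lee_fin /s nnsfun_approxE; apply: le_approx => //.
  by move=> y _; rewrite lee_fin.
have scvg x : s n x @[n --> \oo] --> phi x.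
  have : EFin \o s^~ x @ \oo --> (phi x)%:E.
    by apply: (@cvg_nnsfun_approx _ _ _ setT measurableT (EFin \o phi)) => // y _; rewrite lee_fin.
  by move/fine_cvg; apply: cvg_trans; apply: cvg_refl.
have ms n : measurable_fun setT (s n) by [].
have nsle n x : `|s n x| <= phi x by rewrite ger0_norm.
have c1 : Ex (fun w => W w * s n (V w)) @[n --> \oo] --> Ex (fun w => W w * phi (V w)).
  apply: (@Ex_dominated _ _ _ _ _ _ (fun w => K * `|W w|)).
  - by move=> n; apply: measurable_funM; [exact: L1_measurable lW|exact: mphi].
  - by apply: measurable_funM; [exact: L1_measurable lW|exact: mphi].
  - by move=> w; apply: cvgMr; exact: scvg.
  - move=> n w; rewrite normrM mulrC ler_wpM2r//.
    by rewrite (le_trans (nsle _ _))// (le_trans (ler_norm _)).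
  - by apply: L1Z; exact: L1_norm.
have c2 : Ex (fun w => s n (V w)) @[n --> \oo] --> Ex (fun w => phi (V w)).
  apply: (@Ex_dominated _ _ _ _ _ _ (fun w => phi (V w))).
  - by move=> n; exact: mphi.
  - exact: mphi.
  - by move=> w; exact: scvg.
  - by move=> n w; exact: nsle.
  - exact: L1_bounded_comp pK.
have c3 : Ex W * Ex (fun w => s n (V w)) @[n --> \oo] --> Ex W * Ex (fun w => phi (V w)).
  exact: cvgMr.
have E : (fun n => Ex (fun w => W w * s n (V w))) =
    (fun n => Ex W * Ex (fun w => s n (V w))).
  by apply/funext => n; exact: mean_indep_sfun.
rewrite E in c1; exact: cvg_unique c1 c3.
Qed.

End mean_independence.

(** * Expectation of a pairing with mean-independent coefficients *)

Section mean_independent_pairing.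
Context {dO dT : measure_display} {Omega : measurableType dO}
  {T : measurableType dT} {R : realType}.
Variable P : probability Omega R.
Variable V : Omega -> T.
Hypothesis mV : measurable_fun setT V.
Variables (p : nat) (X : 'I_p -> Omega -> R).
Implicit Types f h L : Omega -> R.

Local Notation L1 f := (P.-integrable setT (EFin \o f)).
Local Notation Ex f := (\int[P]_w f w)%R.

Hypothesis lX : forall i, L1 (X i).
Hypothesis iX : forall i, mean_indep_of P V (X i).

(** Formally [mean_pairing] is the conditional expectation of [pairing] given [V], but the
    coefficients [b i (V w)] need not be integrable. *)
Definition pairing (b : 'I_p -> T -> R) w := \sum_i b i (V w) * X i w.
Definition mean_pairing (b : 'I_p -> T -> R) w := \sum_i b i (V w) * Ex (X i).
(** The cut-off is made on values of [V], so that the truncated coefficients are bounded functions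
    of [V], to which mean independence applies. *)
Definition trunc (b : 'I_p -> T -> R) (n : nat) : set T := [set u | forall i, `|b i u| <= n%:R].

Section fixed_coefficients.
Variable b : 'I_p -> T -> R.
Hypothesis mb : forall i, measurable_fun setT (b i).

Lemma measurable_trunc n : measurable (trunc b n).
Proof.
have -> : trunc b n = \bigcap_(i in [set: 'I_p]) ((fun u => `|b i u|) @^-1` `]-oo, n%:R]).
  by apply/seteqP; split=> u H i; [move=> _; rewrite /= in_itv /=; exact: H|
    have := H i I; rewrite /= in_itv].
apply: fin_bigcap_measurable; first exact: finite_finset.
move=> i _; rewrite -[X in measurable X]setTI.
have mab : measurable_fun setT (fun u => `|b i u|) by exact: measurableT_comp.
exact: mab.
Qed.

Let m1 n : measurable_fun setT (\1_(trunc b n) : T -> R).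
Proof. by apply: measurable_indic; exact: measurable_trunc. Qed.

Let mE n : measurable (V @^-1` trunc b n).
Proof. by rewrite -[X in measurable X]setTI; apply: mV => //; exact: measurable_trunc. Qed.

Let E_homo : {homo (fun n => V @^-1` trunc b n) : m n / (m <= n)%N >-> (m `<=` n)}.
Proof. by move=> m n mn w /= H i; rewrite (le_trans (H i))// ler_nat. Qed.

Lemma trunc_cover u : exists n, trunc b n u.
Proof.
pose S := \sum_i `|b i u|.
have S0 : 0 <= S by exact: sumr_ge0.
exists (Num.truncn S).+1 => i; apply: ltW.
apply: le_lt_trans (truncnS_gt S).
by rewrite /S (bigD1 i)//= lerDl sumr_ge0.
Qed.

Let E_cover w : exists n, (V @^-1` trunc b n) w.
Proof. exact: trunc_cover. Qed.

Let bound1 n x : `|\1_(trunc b n) x : R| <= 1.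
Proof. by rewrite indicE; case: (_ \in _); rewrite ?normr1 ?normr0. Qed.

Let mbV i : measurable_fun setT (fun w => b i (V w)).
Proof. exact: measurableT_comp (mb i) mV. Qed.

Lemma measurable_pairing : measurable_fun setT (pairing b).
Proof.
apply: measurable_sum => i; apply: measurable_funM; [exact: mbV|].
exact: L1_measurable (lX i).
Qed.

Let measurable_mean : measurable_fun setT (mean_pairing b).
Proof.
apply: measurable_sum => i; apply: measurable_funM; first exact: mbV.
exact: measurable_cst.
Qed.

Let bounded_trunc n i x : `|b i x * \1_(trunc b n) x| <= n%:R.
Proof.
rewrite indicE normrM; have [|_] := boolP (x \in trunc b n).
  by rewrite inE => /(_ i); rewrite normr1 mulr1.
by rewrite normr0 mulr0.
Qed.

Lemma pairing_trunc n :
  [/\ L1 (fun w => pairing b w * \1_(trunc b n) (V w)),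
      L1 (fun w => mean_pairing b w * \1_(trunc b n) (V w)) &
      Ex (fun w => pairing b w * \1_(trunc b n) (V w)) =
      Ex (fun w => mean_pairing b w * \1_(trunc b n) (V w))].
Proof.
have mbt i : measurable_fun setT (fun x => b i x * \1_(trunc b n) x : R).
  exact: measurable_funM.
have pE w : pairing b w * \1_(trunc b n) (V w) =
    \sum_i X i w * (b i (V w) * \1_(trunc b n) (V w)).
  by rewrite mulr_suml; apply: eq_bigr => i _; rewrite mulrAC mulrC.
have gE w : mean_pairing b w * \1_(trunc b n) (V w) =
    \sum_i Ex (X i) * (b i (V w) * \1_(trunc b n) (V w)).
  by rewrite mulr_suml; apply: eq_bigr => i _; rewrite mulrAC mulrC.
have l1 i : L1 (fun w => X i w * (b i (V w) * \1_(trunc b n) (V w))).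
  exact: (L1_bounded (phi := fun x => b i x * \1_(trunc b n) x) mV (lX i) (mbt i) (bounded_trunc n i)).
have l2 i : L1 (fun w => b i (V w) * \1_(trunc b n) (V w)).
  exact: (L1_bounded_comp P (phi := fun x => b i x * \1_(trunc b n) x) mV (mbt i) (bounded_trunc n i)).
split.
- by under eq_fun do rewrite pE; exact: L1_sum.
- by under eq_fun do rewrite gE; apply: L1_sum => i; exact: L1Z.
under eq_Rintegral do rewrite pE; under [RHS]eq_Rintegral do rewrite gE.
rewrite !Ex_sum//; last by move=> i; exact: L1Z.
apply: eq_bigr => i _; rewrite ExZ//.
exact: (mean_indep_bounded mV (lX i) (iX i) (mbt i) (bounded_trunc n i)).
Qed.

Lemma L1_trunc f n : L1 f -> L1 (fun w => f w * \1_(trunc b n) (V w)).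
Proof. by move=> lf; exact: (L1_bounded mV lf (m1 n) (@bound1 n)). Qed.

Lemma Ex_trunc_le f n : L1 f ->
  Ex (fun w => f w * \1_(trunc b n) (V w)) <= Ex (fun w => `|f w|).
Proof.
move=> lf; apply: le_Rintegral => //; [exact: L1_trunc|exact: L1_norm|].
move=> w _; rewrite (le_trans (ler_norm _))// normrM ler_piMr//.
Qed.

Lemma Ex_trunc_cvg f : L1 f ->
  Ex (fun w => f w * \1_(trunc b n) (V w)) @[n --> \oo] --> Ex f.
Proof.
move=> lf; apply: (@Ex_dominated _ _ _ _ _ _ (fun w => `|f w|)).
- by move=> n; exact/L1_measurable/L1_trunc.
- exact: L1_measurable lf.
- move=> w; apply: cvg_near_cst; have [n En] := E_cover w; exists n => // m /= nm.
  by rewrite indicE mem_set ?mulr1//; exact: E_homo nm _ En.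
- by move=> n w; rewrite normrM ler_piMr.
- exact: L1_norm.
Qed.

Lemma L1_trunc_exhaust f (K : R) : measurable_fun setT f ->
  (forall n, L1 (fun w => `|f w| * \1_(trunc b n) (V w)) /\
     Ex (fun w => `|f w| * \1_(trunc b n) (V w)) <= K) -> L1 f.
Proof.
by move=> mf fK; apply: (L1_exhaust (E := fun n => V @^-1` trunc b n) (K := K)).
Qed.

(** The truncated expectations of the nonnegative function [pairing b - h] equal those of
    [mean_pairing b - h], hence are bounded, and monotone convergence makes the pairing integrable.
    Dominated convergence then carries the truncated identities to the limit. *)
Lemma pairing_ge h : L1 (mean_pairing b) -> L1 h -> {ae P, forall w, h w <= pairing b w} ->
  L1 (pairing b) /\ Ex (pairing b) = Ex (mean_pairing b).
Proof.
move=> lg lh hT.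
have mT := measurable_pairing; have mh := L1_measurable lh.
have mf : measurable_fun setT (fun w => pairing b w - h w).
  exact: measurable_funB.
have lf : L1 (fun w => pairing b w - h w).
  apply: (L1_trunc_exhaust (K := Ex (fun w => `|mean_pairing b w - h w|))) => // n.
  have [lTn lgn ETn] := pairing_trunc n.
  have mfn : measurable_fun setT (fun w => `|pairing b w - h w| * \1_(trunc b n) (V w) : R).
    apply: measurable_funM; first exact: measurableT_comp.
    exact: measurableT_comp (m1 n) mV.
  have lTh : L1 (fun w => (pairing b w - h w) * \1_(trunc b n) (V w)).
    by under eq_fun do rewrite mulrBl; apply: L1B => //; exact: L1_trunc.
  split.
    apply: (@L1_le _ _ _ _ _ _ mfn _ (L1_norm lTh)) => w.
    by rewrite !normrM normr_id.
  rewrite [leLHS](_ : _ = Ex (fun w => (pairing b w - h w) * \1_(trunc b n) (V w))); last first.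
    apply: Ex_ae => //; first exact: L1_measurable lTh.
    by apply: filterS hT => w hTw; rewrite ger0_norm// subr_ge0.
  apply: le_trans (Ex_trunc_le n (L1B lg lh)).
  under eq_Rintegral do rewrite mulrBl; under [leRHS]eq_Rintegral do rewrite mulrBl.
  by rewrite !ExB ?ETn//; exact: L1_trunc.
have lT : L1 (pairing b).
  have := L1D lf lh; by under eq_fun do rewrite subrK.
split=> //.
have cT := Ex_trunc_cvg lT; have cg := Ex_trunc_cvg lg.
rewrite (_ : (fun n => _) = (fun n => Ex (fun w => mean_pairing b w * \1_(trunc b n) (V w)))) in cT.
  exact: cvg_unique cT cg.
by apply/funext => n; have [] := pairing_trunc n.
Qed.

(** The upper bound [h] on the pairing controls the truncated expectations of [mean_pairing b],
    which agree with those of the pairing; the lower bound [L] controls its negative part. *)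
Lemma L1_mean h L : L1 h -> L1 L -> {ae P, forall w, pairing b w <= h w} ->
  {ae P, forall w, L w <= mean_pairing b w} -> L1 (mean_pairing b).
Proof.
move=> lh lL Th Lg; have mg := measurable_mean.
apply: (L1_trunc_exhaust (K := Ex (fun w => `|h w|) + 2 * Ex (fun w => `|L w|))) => // n.
have [lTn lgn ETn] := pairing_trunc n.
have mgn : measurable_fun setT (fun w => `|mean_pairing b w| * \1_(trunc b n) (V w) : R).
  apply: measurable_funM; first exact: measurableT_comp.
  exact: measurableT_comp (m1 n) mV.
have lagn : L1 (fun w => `|mean_pairing b w| * \1_(trunc b n) (V w)).
  apply: (@L1_le _ _ _ _ _ _ mgn _ (L1_norm lgn)) => w.
  by rewrite !normrM normr_id.
split=> //.
have lLn := L1_trunc n (L1_norm lL).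
(* A number [g] with [g >= - |L|] satisfies [|g| <= g + 2 * |L|]. *)
apply: (@le_trans _ _ (Ex (fun w => mean_pairing b w * \1_(trunc b n) (V w) +
    2 * (`|L w| * \1_(trunc b n) (V w))))).
  apply: Ex_le_ae => //; first by apply: L1D => //; exact: L1Z.
  apply: filterS Lg => w Lgw; rewrite mulrA -mulrDl ler_wpM2r//.
  have := ler_norm (- L w); rewrite normrN => NL.
  by rewrite ler_norml; have := normr_ge0 (L w) => ?; apply/andP; split; lra.
rewrite ExD//; last exact: L1Z.
rewrite ExZ// -ETn lerD//; last first.
  by rewrite ler_wpM2l// (le_trans (Ex_trunc_le n (L1_norm lL)))//; under eq_Rintegral do rewrite normr_id.
apply: (@le_trans _ _ (Ex (fun w => h w * \1_(trunc b n) (V w)))); last exact: Ex_trunc_le.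
apply: Ex_le_ae => //; first exact: L1_trunc.
by apply: filterS Th => w Thw; rewrite ler_wpM2r// indicE.
Qed.

End fixed_coefficients.

Lemma pairing_le (b : 'I_p -> T -> R) h : (forall i, measurable_fun setT (b i)) ->
  L1 (mean_pairing b) -> L1 h -> {ae P, forall w, pairing b w <= h w} ->
  L1 (pairing b) /\ Ex (pairing b) = Ex (mean_pairing b).
Proof.
move=> mb lg lh Th.
have pN : pairing (fun i u => - b i u) = (fun w => - pairing b w).
  by apply/funext => w; rewrite /pairing -sumrN; apply: eq_bigr => i _; rewrite mulNr.
have gN : mean_pairing (fun i u => - b i u) = (fun w => - mean_pairing b w).
  by apply/funext => w; rewrite /mean_pairing -sumrN; apply: eq_bigr => i _; rewrite mulNr.
have ExN f : L1 f -> Ex (fun w => - f w) = - Ex f.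
  move=> lf; under eq_Rintegral do rewrite -mulN1r.
  by rewrite ExZ// mulN1r.
have mNb i : measurable_fun setT (fun u => - b i u) by exact: measurableT_comp.
have [] := @pairing_ge (fun i u => - b i u) mNb (fun w => - h w).
- by rewrite gN; exact: L1N.
- exact: L1N.
- by rewrite pN; apply: filterS Th => w; rewrite lerN2.
rewrite pN gN => /L1N lp.
have lT : L1 (pairing b) by move: lp; under eq_fun do rewrite opprK.
by rewrite !ExN// => /oppr_inj.
Qed.

End mean_independent_pairing.

(** * Laws and moments of random vectors *)

Section random_vectors.
Context {dO : measure_display} {Omega : measurableType dO} {R : realType}.
Variable P : probability Omega R.

Local Notation L1 f := (P.-integrable setT (EFin \o f)).
Local Notation Ex f := (\int[P]_w f w)%R.

Lemma coord_measurable n (V : Omega -> 'rV[R]_n) i : rand_vec V ->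
  measurable_fun setT (fun w => V w 0 i).
Proof. by move=> mV; exact: measurableT_comp (@coord_borel _ _ i) mV. Qed.

Lemma preimage_measurable n (V : Omega -> 'rV[R]_n) (A : set (borelRV R n)) :
  rand_vec V -> measurable A -> measurable (V @^-1` A).
Proof. by move=> mV mA; rewrite -[X in measurable X]setTI; exact: mV. Qed.

Lemma dotv_measurable n (V W : Omega -> 'rV[R]_n) : rand_vec V -> rand_vec W ->
  measurable_fun setT (fun w => dotv (V w) (W w)).
Proof.
move=> mV mW; apply: measurable_sum => i.
by apply: measurable_funM; exact: coord_measurable.
Qed.

Lemma has_law_integral n (mu : probability (borelRV R n) R) (V : Omega -> 'rV[R]_n)
    (phi : borelRV R n -> R) : rand_vec V -> has_law P V mu ->
  measurable_fun setT phi -> (forall u, 0 <= phi u) ->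
  (\int[P]_w (phi (V w))%:E = \int[mu]_u (phi u)%:E)%E.
Proof.
move=> mV lV mphi phi0.
have mEphi : measurable_fun setT (EFin \o phi) by exact/measurable_EFinP.
have := @ge0_integral_pushforward _ _ _ _ R _ mV P setT (EFin \o phi) measurableT mEphi.
rewrite preimage_setT => <-; last by move=> u _; rewrite lee_fin.
by apply: eq_measure_integral => A mA _; exact: lV.
Qed.

(** Equality of laws transfers integrals of nonnegative functions. It is applied to [|phi|], for
    integrability, and to [|phi| + phi], from which the expectation of [phi] follows by
    subtraction. *)
Lemma same_law n (mu : probability (borelRV R n) R) (V W : Omega -> 'rV[R]_n)
    (phi : borelRV R n -> R) : rand_vec V -> has_law P V mu ->
  rand_vec W -> has_law P W mu -> measurable_fun setT phi ->
  L1 (fun w => phi (V w)) ->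
  L1 (fun w => phi (W w)) /\ Ex (fun w => phi (W w)) = Ex (fun w => phi (V w)).
Proof.
move=> mV lV mW lW mphi lphi.
have pos (psi : borelRV R n -> R) : measurable_fun setT psi -> (forall u, 0 <= psi u) ->
    (\int[P]_w (psi (W w))%:E = \int[P]_w (psi (V w))%:E)%E.
  by move=> mpsi psi0; rewrite !(@has_law_integral _ mu).
have lphi' : L1 (fun w => phi (W w)).
  apply/integrableP; split.
    by apply/measurable_EFinP; exact: measurableT_comp mphi mW.
  move/integrableP : lphi => [_].
  have /= := pos (fun u => `|phi u|).
  by move=> ->//; exact: measurableT_comp.
split=> //; pose K := fun u => `|phi u| + phi u.
have mK : measurable_fun setT K.
  by apply: measurable_funD => //; exact: measurableT_comp.
have mN : measurable_fun setT (fun u => `|phi u|) by exact: measurableT_comp.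
have K0 u : 0 <= K u by have := ler_norm (- phi u); rewrite normrN /K; lra.
have eK : Ex (fun w => K (W w)) = Ex (fun w => K (V w)).
  by rewrite /Rintegral pos.
have eN : Ex (fun w => `|phi (W w)|) = Ex (fun w => `|phi (V w)|).
  by rewrite /Rintegral (pos (fun u => `|phi u|)).
by move: eK; rewrite /K !ExD// ?eN; [exact: addrI|exact: L1_norm..].
Qed.

Lemma has_law_ae n (mu : probability (borelRV R n) R) (V : Omega -> 'rV[R]_n)
    (A : set 'rV[R]_n) : rand_vec V -> has_law P V mu -> mu.-negligible (~` A) ->
  {ae P, forall w, A (V w)}.
Proof.
move=> mV lV [N [mN N0 AN]]; exists (V @^-1` N); split.
- exact: preimage_measurable.
- by rewrite lV.
- by move=> w /= /AN.
Qed.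

Lemma mean_indepP n p (X : Omega -> 'rV[R]_p) (V : Omega -> 'rV[R]_n) i :
  rand_vec V -> mean_indep P X V ->
  L1 (fun w => X w 0 i) /\
  mean_indep_of P (V : Omega -> borelRV R n) (fun w => X w 0 i).
Proof.
move=> mV [lX iX]; split; first exact: lX.
move=> A mA; have mE := preimage_measurable mV mA.
have Efin : (\int[P]_w (X w 0 i)%:E)%E \is a fin_num by exact: integrable_fin_num (lX i).
have E1 : Ex (fun w => \1_A (V w)) = fine (P (V @^-1` A)).
  rewrite /Rintegral; congr fine.
  by have := integral_indic P measurableT mE; rewrite setIT => <-.
rewrite E1 mulrC {2}/Rintegral -fineM ?fin_num_measure// -iX//.
rewrite /Rintegral; congr fine; rewrite [RHS]integral_mkcond epatch_indic.
by apply: eq_integral => w _ /=; rewrite EFinM.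
Qed.

Lemma L1_sqnorm n (V : Omega -> 'rV[R]_n) : rand_vec V ->
  (\int[P]_w (sqnorm (V w))%:E < +oo)%E -> L1 (fun w => sqnorm (V w)).
Proof.
move=> mV fV; apply/integrableP; split.
  by apply/measurable_EFinP; exact: dotv_measurable.
rewrite (eq_integral (fun w => (sqnorm (V w))%:E))// => w _ /=.
by rewrite ger0_norm// sumr_ge0// => i _; rewrite -expr2 sqr_ge0.
Qed.

Lemma coord_sqr_le n (u : 'rV[R]_n) i : u 0 i * u 0 i <= sqnorm u.
Proof.
by rewrite /sqnorm /dotv (bigD1 i)//= lerDl sumr_ge0// => j _; rewrite -expr2 sqr_ge0.
Qed.

Lemma L1_coord n (V : Omega -> 'rV[R]_n) i : rand_vec V ->
  L1 (fun w => sqnorm (V w)) -> L1 (fun w => V w 0 i).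
Proof.
move=> mV lV; apply: (@L1_le _ _ _ _ _ (fun w => 1 + sqnorm (V w))).
- exact: coord_measurable.
- by move=> w; have := coord_sqr_le (V w) i; rewrite ler_norml => ?; apply/andP; split; nra.
- by apply: L1D => //; exact: L1_cst.
Qed.

Lemma L1_dotv n (V W : Omega -> 'rV[R]_n) : rand_vec V -> rand_vec W ->
  L1 (fun w => sqnorm (V w)) -> L1 (fun w => sqnorm (W w)) ->
  L1 (fun w => dotv (V w) (W w)).
Proof.
move=> mV mW lV lW; apply: (@L1_le _ _ _ _ _ (fun w => sqnorm (V w) + sqnorm (W w))).
- exact: dotv_measurable.
- move=> w; rewrite -big_split/= (le_trans (ler_norm_sum _ _ _))//.
  by apply: ler_sum => i _; rewrite ler_norml; apply/andP; split; nra.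
- exact: L1D.
Qed.

End random_vectors.

(** * Optimality of subgradient representations *)

Section duality.
Context {dO : measure_display} {Omega : measurableType dO} {R : realType}.
Variables (P : probability Omega R) (d p : nat).
Variables (FU : probability (borelRV R d) R).
Variables (Y : Omega -> 'rV[R]_d) (X : Omega -> 'rV[R]_p).
Hypothesis mY : rand_vec Y.
Hypothesis Y2 : (\int[P]_w (sqnorm (Y w))%:E < +oo)%E.
Hypothesis U2 : (\int[FU]_u (sqnorm u)%:E < +oo)%E.

Local Notation L1 f := (P.-integrable setT (EFin \o f)).
Local Notation Ex f := (\int[P]_w f w)%R.

Lemma L1_sqnorm_law V : rand_vec V -> has_law P V FU -> L1 (fun w => sqnorm (V w)).
Proof.
move=> mV lV; apply: L1_sqnorm => //.
rewrite (@has_law_integral _ _ _ _ _ FU V (fun u => sqnorm u))//.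
- by apply: measurable_sum => i; apply: measurable_funM; exact: coord_borel.
- by move=> u; rewrite sumr_ge0// => i _; rewrite -expr2 sqr_ge0.
Qed.

Lemma EdotE V : rand_vec V -> has_law P V FU ->
  L1 (fun w => dotv (V w) (Y w)) /\ Edot P V Y = (Ex (fun w => dotv (V w) (Y w)))%:E.
Proof.
move=> mV lV; have lVY : L1 (fun w => dotv (V w) (Y w)).
  by apply: L1_dotv => //; [exact: L1_sqnorm_law|exact: L1_sqnorm].
by split=> //; rewrite /Rintegral fineK//; exact: integrable_fin_num.
Qed.

Variables (G : set 'rV[R]_d) (b : 'rV[R]_d -> 'rV[R]_p).
Variables (beta : 'rV[R]_d -> 'M[R]_(p, d)) (U1 : Omega -> 'rV[R]_d).
Hypothesis mG : measurable (G : set (borelRV R d)).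
Hypothesis nG : FU.-negligible (~` G).
Hypothesis mb : forall i,
  measurable_fun (G : set (borelRV R d)) (fun u : borelRV R d => b u 0 i).
Hypothesis fU1 : feasible P FU X U1.
Hypothesis YE : {ae P, forall w, Y w = X w *m beta (U1 w)}.
Hypothesis sub : {ae P, forall w u v, G u -> G v ->
  dotv (b u) (X w) + dotv (X w *m beta u) (v - u) <= dotv (b v) (X w)}.

(** The gap in the subgradient inequality from [U1] to [V] is nonnegative, and its expectation is
    E(U1.Y) - E(V.Y) because the two pairings have equal expectations; if that is at most 0 the gap
    vanishes almost surely. Integrability is gained in the order: mean pairing at [U1], mean pairing
    at [V] by equality of laws, pairing at [U1], pairing at [V]. *)
Lemma subgradient_optimal V : feasible P FU X V ->
  (Edot P V Y <= Edot P U1 Y)%E /\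
  ((Edot P U1 Y <= Edot P V Y)%E -> {ae P, forall w,
     dotv (b (V w)) (X w) = dotv (b (U1 w)) (X w) + dotv (Y w) (V w - U1 w)}).
Proof.
move=> [mV [lV iV]]; have [mU [lU iU]] := fU1.
have lX i := (mean_indepP i mV iV).1.
(* Extension by 0 outside [G], measurable on the whole space; [U1] and [V] lie in [G] almost
   surely. *)
pose c i : borelRV R d -> R := (fun u => b u 0 i) \_ G.
have mc i : measurable_fun setT (c i) by apply/(measurable_restrictT _ mG); exact: mb.
pose x i w := X w 0 i.
have cG u w : G u -> \sum_i c i u * x i w = dotv (b u) (X w).
  by move=> Gu; apply: eq_bigr => i _; rewrite /c patchE mem_set.
have aeU := has_law_ae mU lU nG; have aeV := has_law_ae mV lV nG.
have [u0 Gu0] : exists u0, G u0.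
  apply: contrapT => /forallNP G0.
  have : FU.-negligible setT.
    by apply: negligibleS nG => u _; exact: G0.
  by move/(negligibleP _ measurableT) => /=; rewrite probability_setT => /eqP; rewrite onee_eq0.
have sqY : L1 (fun w => sqnorm (Y w)) by exact: L1_sqnorm.
have sqU := L1_sqnorm_law mU lU.
have lx i : L1 (x i) by exact: lX.
have lconst (a : 'I_p -> R) : L1 (fun w => \sum_i a i * x i w).
  by apply: L1_sum => i; apply: L1Z; exact: lx.
have Econst (a : 'I_p -> R) : Ex (fun w => \sum_i a i * x i w) = \sum_i a i * Ex (x i).
  rewrite Ex_sum; last by move=> i; apply: L1Z; exact: lx.
  by apply: eq_bigr => i _; rewrite ExZ.
have lYu0 : L1 (fun w => dotv (Y w) u0).
  apply: L1_sum => i; under eq_fun do rewrite mulrC.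
  by apply: L1Z; exact: L1_coord.
have [lUY EU] := EdotE mU lU; have [lVY EV] := EdotE mV lV.
(* The subgradient inequality from [U1 w] to the fixed point [u0]: an integrable upper bound for the
   pairing at [U1]. *)
pose h w := \sum_i c i u0 * x i w - (dotv (Y w) u0 - dotv (U1 w) (Y w)).
have lh : L1 h by apply: L1B => //; exact: L1B.
have Th : {ae P, forall w, pairing (U1 : Omega -> borelRV R d) x c w <= h w}.
  apply: filterS3 aeU YE sub => w GU YEw /(_ (U1 w) u0 GU Gu0).
  by rewrite /pairing /h !cG// -YEw dotvBr (dotvC (U1 w)); lra.
(* The subgradient inequality from [u0] to [U1 w], integrated over [X] alone with [U1 w] frozen,
   gives the lower bound [L]; [a] is E(X) times [beta u0]. *)
pose a := fun j : 'I_d => \sum_i Ex (x i) * beta u0 i j.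
pose L w := \sum_i c i u0 * Ex (x i) + \sum_j a j * (U1 w 0 j - u0 0 j).
have lL : L1 L.
  apply: L1D; first exact: L1_cst.
  by apply: L1_sum => j; apply: L1Z; apply: L1B; [exact: L1_coord|exact: L1_cst].
have Lg : {ae P, forall w, L w <= mean_pairing P (U1 : Omega -> borelRV R d) x c w}.
  apply: filterS aeU => w GU; rewrite /mean_pairing -Econst.
  have -> : L w = Ex (fun w' => \sum_i (c i u0 +
      \sum_j beta u0 i j * (U1 w 0 j - u0 0 j)) * x i w').
    rewrite Econst /L; under [RHS]eq_bigr do rewrite mulrDl.
    rewrite big_split/=; congr (_ + _).
    under eq_bigr do rewrite /a mulr_suml; rewrite exchange_big/=.
    by apply: eq_bigr => i _; rewrite mulr_suml; apply: eq_bigr => j _; ring.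
  apply: Ex_le_ae => //; apply: filterS sub => w' /(_ u0 (U1 w) Gu0 GU).
  rewrite (cG (U1 w))//; congr (_ <= _); rewrite -(cG _ _ Gu0).
  under [RHS]eq_bigr do rewrite mulrDl.
  rewrite [RHS]big_split/=; congr (_ + _).
  rewrite /dotv; under [LHS]eq_bigr do rewrite !mxE mulr_suml.
  rewrite exchange_big/=; apply: eq_bigr => i _; rewrite mulr_suml.
  by apply: eq_bigr => j _; rewrite /x; ring.
have ixU i : mean_indep_of P (U1 : Omega -> borelRV R d) (x i).
  exact: (mean_indepP i mU iU).2.
have ixV i : mean_indep_of P (V : Omega -> borelRV R d) (x i).
  exact: (mean_indepP i mV iV).2.
have lgU : L1 (mean_pairing P (U1 : Omega -> borelRV R d) x c) by exact: (L1_mean mU lx ixU mc lh lL Th Lg).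
have mg : measurable_fun setT (fun u => \sum_i c i u * Ex (x i)).
  by apply: measurable_sum => i; apply: measurable_funM => //; exact: measurable_cst.
have [lgV EgV] := same_law mU lU mV lV mg lgU.
have [lTU ETU] := pairing_le mU lx ixU mc lgU lh Th.
pose D w := dotv (V w) (Y w) - dotv (U1 w) (Y w).
have lD : L1 D by exact: L1B.
(* Once the pairing at [U1] is integrable, this is an integrable lower bound for the pairing at
   [V]. *)
have TUV : {ae P, forall w, pairing (U1 : Omega -> borelRV R d) x c w + D w <=
    pairing (V : Omega -> borelRV R d) x c w}.
  near=> w; have GU : G (U1 w) by near: w.
  have GV : G (V w) by near: w.
  have YEw : Y w = X w *m beta (U1 w) by near: w.
  have : dotv (b (U1 w)) (X w) + dotv (X w *m beta (U1 w)) (V w - U1 w) <=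
      dotv (b (V w)) (X w) by near: w; apply: filterS3 aeU aeV sub => w ? ?; exact.
  by rewrite /pairing !cG// -YEw dotvBr /D !(dotvC _ (Y w)).
have [lTV ETV] := pairing_ge mV lx ixV mc lgV (L1D lTU lD) TUV.
have ETT : Ex (pairing (V : Omega -> borelRV R d) x c) =
    Ex (pairing (U1 : Omega -> borelRV R d) x c) by rewrite ETV ETU.
have ED : Ex D = Ex (fun w => dotv (V w) (Y w)) - Ex (fun w => dotv (U1 w) (Y w)).
  by rewrite ExB.
split.
  rewrite EU EV lee_fin -subr_le0 -ED.
  have := Ex_le_ae (L1D lTU lD) lTV TUV; rewrite ExD// ETT; lra.
rewrite EU EV lee_fin -subr_ge0 -ED => ED0.
pose Delta w := pairing (V : Omega -> borelRV R d) x c w -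
  (pairing (U1 : Omega -> borelRV R d) x c w + D w).
have lDelta : L1 Delta by apply: L1B => //; exact: L1D.
have Delta0 : {ae P, forall w, 0 <= Delta w}.
  by apply: filterS TUV => w; rewrite subr_ge0.
have EDelta : Ex Delta = 0.
  apply/eqP; rewrite eq_le; apply/andP; split; last first.
    by have := Ex_le_ae (L1_cst P 0) lDelta Delta0; rewrite Ex_cst.
  by rewrite (ExB lTV (L1D lTU lD)) (ExD lTU lD) ETT opprD addrA subrr add0r oppr_le0.
have := Ex_ge0_eq0_ae lDelta Delta0 EDelta.
apply: filterS3 aeU aeV => w GU GV; rewrite /Delta /pairing !cG// /D.
by rewrite dotvBr !(dotvC _ (Y w)) => ?; lra.
Unshelve. all: by end_near.
Qed.

End duality.

Lemma rv_support_ae (dO : measure_display) (Omega : measurableType dO)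
    (R : realType) (P : probability Omega R) (p : nat) (X : Omega -> 'rV[R]_p) :
  rand_vec X -> {ae P, forall w, rv_support P X (X w)}.
Proof.
move=> mX.
pose XB : Omega -> borelRV R p := X.
pose X' : {mfun Omega >-> borelRV R p} :=
  HB.pack XB (isMeasurableFun.Build _ _ _ _ XB mX).
have [N [mN N0 AN]] := msupport_compl_negligible (distribution P X').
exists (X @^-1` N); split=> //; first exact: preimage_measurable.
by move=> w /= nw; apply: AN => /= nw'; apply: nw => A oA Aw; exact: nw'.
Qed.

(** Countably many exceptional sets are merged into one Borel set of full mass, on which
    measurability of the potentials can be stated. *)
Lemma leb_ae_in_borel (R : realType) (d : nat) (FU : probability (borelRV R d) R)
    (I : countType) (Q : I -> 'rV[R]_d -> Prop) :
  has_lebesgue_density FU -> (forall i, leb_ae_in (msupport FU) (Q i)) ->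
  exists G : set 'rV[R]_d, [/\ measurable (G : set (borelRV R d)),
    FU.-negligible (~` G), G `<=` msupport FU & forall i u, G u -> Q i u].
Proof.
move=> dFU /choice[N NP].
have : FU.-negligible (\bigcup_i N i).
  apply: negligible_bigcup_countable => i.
  by apply: null_negligible => //; have [] := NP i.
move=> [A [mA A0 NA]]; exists (msupport FU `&` ~` A); split.
- apply: measurableI; last exact: measurableC.
  by apply: closed_borel; exact: closed_msupport.
- rewrite setCI setCK; apply: negligibleU; first exact: msupport_compl_negligible.
  exact/negligibleP.
- by move=> u [].
- by move=> i u [Uu nAu]; apply: (NP i).2 => // Niu; apply: nAu; apply: NA; exists i.
Qed.

Section representation.
Context {dO : measure_display} {Omega : measurableType dO} {R : realType}.
Variables (P : probability Omega R) (d p : nat).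
Variables (FU : probability (borelRV R d) R).
Variables (Y : Omega -> 'rV[R]_d) (X : Omega -> 'rV[R]_p).
Hypotheses (mY : rand_vec Y) (mX : rand_vec X).
Hypothesis dFU : has_lebesgue_density FU.
Hypothesis cU : convex_set (msupport FU).
Hypothesis Y2 : (\int[P]_w (sqnorm (Y w))%:E < +oo)%E.
Hypothesis U2 : (\int[FU]_u (sqnorm u)%:E < +oo)%E.

(** Linearity of [Phi B x] in [x] gives one full set [G] on which the subgradient inequality holds
    for every [x] in the support of [X]. For another maximizer that inequality is an equality, which
    strict convexity excludes unless [V = U]. *)
Lemma linear_potential_optimal (U : Omega -> 'rV[R]_d)
    (beta : 'rV[R]_d -> 'M[R]_(p, d)) (B : 'rV[R]_d -> 'rV[R]_p) :
  feasible P FU X U ->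
  {ae P, forall w, Y w = X w *m beta (U w)} ->
  (forall x, rv_support P X x ->
     leb_ae_in (msupport FU) (fun u => is_gradient (Phi B x) u (x *m beta u))) ->
  {within msupport FU, continuous B} ->
  (forall x, rv_support P X x -> strictly_convex_on (msupport FU) (Phi B x)) ->
  forall V, feasible P FU X V -> (Edot P V Y <= Edot P U Y)%E /\
    ((Edot P U Y <= Edot P V Y)%E -> {ae P, forall w, V w = U w}).
Proof.
move=> fU YE gB cB scB V fV.
have [m [M [SM spM]]] := spanning_rows (rv_support P X).
have [|G [mG nG GU gG]] := leb_ae_in_borel
  (Q := fun i u => is_gradient (Phi B (row i M)) u (row i M *m beta u)) dFU.
  by move=> i; exact/gB/SM.
have gX x u : rv_support P X x -> G u -> is_gradient (Phi B x) u (x *m beta u).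
  by move=> Sx Gu; apply: is_gradient_Phi_span (spM _ Sx) => i; exact: gG.
have aeX := rv_support_ae P mX.
have sub : {ae P, forall w u v, G u -> G v ->
    dotv (B u) (X w) + dotv (X w *m beta u) (v - u) <= dotv (B v) (X w)}.
  apply: filterS aeX => w Sw u v Gu Gv.
  exact: is_gradient_le (scB _ Sw) (GU _ Gu) (GU _ Gv) (gX _ _ Sw Gu).
have mB i : measurable_fun (G : set (borelRV R d)) (fun u : borelRV R d => B u 0 i).
  apply: within_continuous_borel => //.
  apply: (continuous_subspaceW GU) => u.
  by apply: (@continuous_comp (subspace (msupport FU)) _ _ B (fun v : 'rV[R]_p => v 0 i));
    [exact: cB|exact: coord_continuous].
have [leVU eqVU] := subgradient_optimal mY Y2 U2 mG nG mB fU YE sub fV.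
split=> // /eqVU TE.
have [mV [lV _]] := fV; have [mU [lU _]] := fU.
near=> w.
have GUw : G (U w) by near: w; exact: has_law_ae lU nG.
have Vw : msupport FU (V w).
  by near: w; apply: has_law_ae lV _ => //; exact: msupport_compl_negligible.
have Sw : rv_support P X (X w) by near: w.
have YEw : Y w = X w *m beta (U w) by near: w.
have TEw : dotv (B (V w)) (X w) = dotv (B (U w)) (X w) + dotv (Y w) (V w - U w).
  by near: w.
apply: contrapT => /eqP VU.
(* At the midpoint strict convexity puts the potential strictly below the chord, which by [TEw]
   coincides with the tangent at [U w], while the gradient inequality puts it above that tangent. *)
have h01 : 0 < (2^-1 : R) < 1 by apply/andP; split; lra.
have Vhalf : msupport FU (2^-1 *: V w + (1 - 2^-1) *: U w).
  apply: convex_setP => //; first exact: GU.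
  by apply/andP; split; lra.
have := is_gradient_le (scB _ Sw) (GU _ GUw) Vhalf (gX _ _ Sw GUw).
have := scB _ Sw _ _ _ Vw (GU _ GUw) VU h01.
rewrite -YEw (_ : _ + _ - U w = 2^-1 *: (V w - U w)); last first.
  by apply/rowP => i; rewrite !mxE; field.
rewrite /Phi TEw dotvZr; lra.
Unshelve. all: by end_near.
Qed.

(** The potential depends on [X w] in an arbitrary way. A spanning family is taken among the [x]
    that admit a potential, and [comb_subgradient] compares the linear combination with the
    potential of [X w] itself. *)
Lemma convex_potential_optimal (U : Omega -> 'rV[R]_d)
    (beta : 'rV[R]_d -> 'M[R]_(p, d)) :
  feasible P FU X U ->
  {ae P, forall w, Y w = X w *m beta (U w)} ->
  {ae P, forall w, exists phi : 'rV[R]_d -> R,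
     strictly_convex_on (msupport FU) phi /\
     leb_ae_in (msupport FU) (fun u => is_gradient phi u (X w *m beta u))} ->
  forall V, feasible P FU X V -> (Edot P V Y <= Edot P U Y)%E.
Proof.
move=> fU YE gphi V fV.
pose S := [set x | exists phi : 'rV[R]_d -> R, strictly_convex_on (msupport FU) phi /\
   leb_ae_in (msupport FU) (fun u => is_gradient phi u (x *m beta u))].
have [m [M [SM spM]]] := spanning_rows S.
have /choice[phi phiP] : forall i, exists phi : 'rV[R]_d -> R,
    strictly_convex_on (msupport FU) phi /\
    leb_ae_in (msupport FU) (fun u => is_gradient phi u (row i M *m beta u)) := SM.
have [|G [mG nG GU gG]] := leb_ae_in_borel
  (Q := fun i u => is_gradient (phi i) u (row i M *m beta u)) dFU.
  by move=> i; have [] := phiP i.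
(* Chosen so that pairing [b u] with [x] combines the [phi i u] with the coordinates of [x] in the
   rows of [M]. *)
pose b u : 'rV[R]_p := (\row_i phi i u) *m (pinvmx M)^T.
have bE u x : dotv (b u) x = \sum_i (x *m pinvmx M) 0 i * phi i u.
  rewrite dotvE /b -mulmxA -trmx_mul -dotvE dotvC.
  by apply: eq_bigr => i _; rewrite !mxE.
have sub : {ae P, forall w u v, G u -> G v ->
    dotv (b u) (X w) + dotv (X w *m beta u) (v - u) <= dotv (b v) (X w)}.
  apply: filterS gphi => w [phi0 [sc0 g0]] u v Gu Gv.
  have Xw : X w *m pinvmx M *m M = X w by apply: mulmxKpV; apply: spM; exists phi0.
  rewrite !bE -{2}Xw.
  apply: (@comb_subgradient _ _ _ _ FU M beta phi _ phi0) => //.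
  - by move=> i; have [] := phiP i.
  - by move=> i; have [] := phiP i.
  - by rewrite Xw.
  - exact: GU.
  - exact: GU.
  - by move=> i; exact: gG.
  - by move=> i; exact: gG.
have mb i : measurable_fun (G : set (borelRV R d)) (fun u : borelRV R d => b u 0 i).
  rewrite (_ : (fun u => _) =
    fun u : borelRV R d => \sum_j phi j u * (pinvmx M)^T j i); last first.
    by apply/funext => u; rewrite mxE; apply: eq_bigr => j _; rewrite mxE.
  apply: measurable_sum => j; apply: measurable_funM; last exact: measurable_cst.
  apply: within_continuous_borel => //.
  apply: continuous_in_subspaceT => u; rewrite inE => Gu.
  by apply: differentiable_continuous; have [] := gG j u Gu.
by have [] := subgradient_optimal mY Y2 U2 mG nG mb fU YE sub fV.
Qed.

End representation.

(** * Hyperplanes are null *)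

Section hyperplanes.
Context {R : realType} {d : nat}.

(** The finite cover is padded with the degenerate box at 0. The index [i0] ensures that this box
    has volume 0; in dimension 0 it would have volume 1. *)
Lemma lebesgue_null_finite (i0 : 'I_d) (A : set 'rV[R]_d) :
  (forall e : R, 0 < e -> exists (T : finType) (lo hi : T -> 'rV[R]_d),
    A `<=` \bigcup_t box (lo t) (hi t) /\ \sum_t boxvol (lo t) (hi t) < e) ->
  lebesgue_null A.
Proof.
move=> H e e0; have [T [lo [hi [cov vol]]]] := H e e0.
pose s (f : T -> 'rV[R]_d) (k : nat) :=
  if insub k is Some o then f (enum_val (o : 'I_#|T|)) else 0.
have sE f (o : 'I_#|T|) : s f o = f (enum_val o) by rewrite /s valK.
have s0 f k : (#|T| <= k)%N -> s f k = 0 by move=> Tk; rewrite /s insubF// ltnNge Tk.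
exists (s lo), (s hi); split.
  move=> x /cov[t _ xt]; exists (enum_rank t : 'I_#|T|) => //.
  by rewrite !sE enum_rankK.
have v0 k : (#|T| <= k)%N -> boxvol (s lo k) (s hi k) = 0.
  move=> Tk; rewrite !s0// /boxvol (bigD1 i0)//= !mxE subrr.
  by rewrite maxxx mul0r.
apply: (@le_lt_trans _ _ (\sum_t boxvol (lo t) (hi t))%:E); last by rewrite lte_fin.
apply: lime_le.
  by apply: is_cvg_nneseries => k _ _; rewrite lee_fin boxvol_ge0.
apply: nearW => n; rewrite sumEFin lee_fin.
apply: (@le_trans _ _ (\sum_(0 <= k < n + #|T|) boxvol (s lo k) (s hi k))).
  rewrite [leRHS](@big_cat_nat _ _ _ n)//= ?leq_addr// lerDl.
  by apply: sumr_ge0 => k _; exact: boxvol_ge0.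
rewrite (@big_cat_nat _ _ _ #|T|)//= ?leq_addl// [X in _ + X]big_nat [X in _ + X]big1 ?addr0; last first.
  by move=> k /andP[Tk _]; exact: v0.
rewrite big_mkord [leRHS](reindex (@enum_val T T))/=; last exact: onW_bij (@enum_val_bij T).
by apply: ler_sum => o _; rewrite !sE.
Qed.

Lemma subdivision (lo L y : R) (k : nat) : 0 < L -> lo <= y <= lo + L ->
  exists o : 'I_k.+1, lo + L * (o%:R / k.+1%:R) <= y <=
    lo + L * (o%:R / k.+1%:R) + L / k.+1%:R.
Proof.
move=> L0 /andP[y1 y2]; pose r := (y - lo) / L.
have r0 : 0 <= r by rewrite divr_ge0 ?subr_ge0// ltW.
have r1 : r <= 1 by rewrite ler_pdivrMr// mul1r lerBlDl.
have yE : y = lo + L * r by rewrite /r; field; exact: lt0r_neq0.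
have k0 : 0 < k.+1%:R :> R by [].
suff : exists o : 'I_k.+1, o%:R <= r * k.+1%:R <= o%:R + 1.
  move=> [q /andP[q1 q2]]; exists q; rewrite yE -addrA -mulrDr !lerD2l !ler_pM2l//.
  by rewrite ler_pdivrMr// q1/= -[X in _ <= _ + X]mul1r -mulrDl ler_pdivlMr.
have rk0 : 0 <= r * k.+1%:R by rewrite mulr_ge0.
have /andP[t1 t2] := truncn_itv rk0.
have [tk|kt] := ltnP (Num.truncn (r * k.+1%:R)) k.+1.
  by exists (Ordinal tk) => /=; rewrite t1 natr1 ltW.
(* At the right end [y = lo + L] the integer part is [k.+1], one too many; the last cell contains
   this point. *)
exists ord_max => /=; rewrite natr1 ler_piMl// andbT.
by apply: le_trans t1; rewrite ler_nat ltnW.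
Qed.

(* The slab around the hyperplane over each cell of the grid in the other
   coordinates is itself cut into [k.+1] pieces, so that the boxes are indexed
   by all of [{ffun 'I_d -> 'I_k.+1}]. *)
Lemma lebesgue_null_hyperplane (a : 'rV[R]_d) (c M : R) : a != 0 -> 0 < M ->
  lebesgue_null [set x | dotv a x = c /\ forall j, `|x 0 j| <= M].
Proof.
move=> a0 M0.
have [j0 aj0] : exists j, a 0 j != 0.
  by move/eqP : a0 => /rowP/existsNP[j]; rewrite mxE => /eqP; exists j.
(* With the largest coefficient as pivot, solving for coordinate [i] involves only ratios of
   absolute value at most 1. *)
have [i ai0 aimax] : exists2 i, a 0 i != 0 & forall j, `|a 0 j| <= `|a 0 i|.
  have [i _ imax] := arg_maxP (fun j => `|a 0 j|) (isT : predT j0).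
  exists i; last by move=> j; exact: imax.
  by rewrite -normr_gt0 (lt_le_trans _ (imax j0 isT))// normr_gt0.
apply: (lebesgue_null_finite i) => e e0.
pose C := \prod_(j < d | j != i) (2 * M).
have C0 : 0 <= C by apply: prodr_ge0 => j _; rewrite mulr_ge0// ltW.
have d0 : 0 < d%:R :> R by rewrite ltr0n (leq_ltn_trans _ (ltn_ord i)).
(* The total volume will be [2 * dl * C], that is [4 * M * d * C / K]; the added 1 keeps [W]
   positive. *)
pose W := 4 * M * d%:R * C + 1.
have W0 : 0 < W by rewrite ltr_wpDl// !mulr_ge0// ltW.
have [k] := ltr_add_invr (divr_gt0 e0 W0); rewrite add0r ltr_pdivlMr// => ke.
pose K : R := k.+1%:R; have K0 : 0 < K by [].
(* Bounds the variation of coordinate [i] along the hyperplane over a cell of side [2 * M / K]. *)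
pose dl := 2 * M * d%:R / K.
have dl0 : 0 < dl by rewrite !mulr_gt0// invr_gt0.
pose g (f : {ffun 'I_d -> 'I_k.+1}) j : R := - M + (2 * M) * ((f j)%:R / K).
pose y f := (c - \sum_(j < d | j != i) a 0 j * g f j) / a 0 i.
pose lo f : 'rV[R]_d := \row_j if j == i then (y f - dl) + (2 * dl) * ((f j)%:R / K)
  else g f j.
pose st j := if j == i then (2 * dl) / K else (2 * M) / K.
pose hi f : 'rV[R]_d := \row_j (lo f 0 j + st j).
have st0 j : 0 <= st j.
  by rewrite /st; case: ifP => _; apply: divr_ge0 (ltW K0); apply: mulr_ge0 => //; exact: ltW.
exists {ffun 'I_d -> 'I_k.+1}, lo, hi; split; last first.
  have volE f : boxvol (lo f) (hi f) = \prod_j st j.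
    by apply: eq_bigr => j _; rewrite !mxE addrAC subrr add0r; apply/max_idPr.
  under eq_bigr do rewrite volE.
  (* The K^d boxes have equal volume; giving one factor [K] to each coordinate leaves [2 * dl] for
     [i] and [2 * M] for the others. *)
  rewrite sumr_const card_ffun !card_ord -mulr_natr natrX -/K.
  rewrite -[X in K ^+ X](card_ord d) -prodr_const -big_split/=.
  rewrite (bigD1 i)//= /st eqxx (divfK (lt0r_neq0 K0)).
  rewrite (eq_bigr (fun=> 2 * M)); last first.
    by move=> j /negPf ->; rewrite divfK// lt0r_neq0.
  rewrite -/C; apply: le_lt_trans ke; rewrite /dl /W -/K.
  have : 0 < K^-1 by rewrite invr_gt0.
  by set K' := K^-1 => ?; nra.
move=> x [ax xM].
have /choice[f0 f0P] : forall j, exists o : 'I_k.+1,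
    - M + (2 * M) * (o%:R / K) <= x 0 j <= - M + (2 * M) * (o%:R / K) + (2 * M) / K.
  move=> j; apply: subdivision; first by rewrite mulr_gt0.
  by have := xM j; rewrite ler_norml => /andP[? ?]; apply/andP; split; lra.
have xy (f : {ffun 'I_d -> 'I_k.+1}) : (forall j, j != i -> f j = f0 j) ->
    y f - dl <= x 0 i <= y f + dl.
  move=> ff0.
  have xi : x 0 i = (c - \sum_(j < d | j != i) a 0 j * x 0 j) / a 0 i.
    by rewrite -ax /dotv (bigD1 i)//= addrK mulrAC divff// mul1r.
  rewrite -ler_distl xi /y -mulrBl opprB [X in X / _]addrC subrKA -sumrB normrM normfV.
  rewrite ler_pdivrMr ?normr_gt0// (le_trans (ler_norm_sum _ _ _))//.
  apply: (@le_trans _ _ (\sum_(j < d) (2 * M / K * `|a 0 i|))); last first.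
    by rewrite sumr_const card_ord -[leLHS]mulr_natr /dl le_eqVlt; apply/orP; left; apply/eqP; ring.
  rewrite big_mkcond/=; apply: ler_sum => j _; case: ifPn => ji.
    rewrite -mulrBr normrM mulrC ler_pM//.
    have : 0 <= 2 * M / K by rewrite !mulr_ge0 ?invr_ge0 ?(ltW M0)// ltW.
    have /andP[] := f0P j; rewrite /g ff0// ler_norml.
    by set q := 2 * M / K; set q' := 2 * M * _ => ? ? ?; apply/andP; split; lra.
  by rewrite !mulr_ge0// ?invr_ge0 ltW.
(* [y f] does not depend on [f i], so the piece of the slab that contains [x 0 i] can be chosen
   last. *)
pose f1 := [ffun j => f0 j].
have [||q oP] := @subdivision (y f1 - dl) (2 * dl) (x 0 i) k.
- by rewrite mulr_gt0.
- by have /andP[? ?] := xy f1 (fun j _ => ffunE _ j); apply/andP; split; lra.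
pose f := [ffun j => if j == i then q else f0 j].
have yE : y f = y f1.
  rewrite /y; congr ((_ - _) / _); apply: eq_bigr => j /negPf ji.
  by rewrite /g !ffunE ji.
exists f => // j; rewrite !mxE yE /st; case: ifPn => [/eqP ->|ji].
  by rewrite ffunE eqxx; exact: oP.
by rewrite /g ffunE (negPf ji); exact: f0P.
Qed.

(** A hyperplane is a countable union of bounded null pieces; if it contained the support, the total
    mass would be 0. *)
Lemma msupport_off_hyperplane (FU : probability (borelRV R d) R) (a : 'rV[R]_d) (c : R) :
  has_lebesgue_density FU -> a != 0 -> exists2 z, msupport FU z & dotv a z != c.
Proof.
move=> dFU a0; apply: contrapT => nex.
have : FU.-negligible setT.
  pose H (n : nat) := [set x : 'rV[R]_d | dotv a x = c /\ forall j, `|x 0 j| <= n.+1%:R].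
  have nH : FU.-negligible (\bigcup_n H n).
    apply: negligible_bigcup => n; apply: null_negligible => //.
    exact: lebesgue_null_hyperplane.
  apply: negligibleS (negligibleU nH (msupport_compl_negligible FU)) => z _.
  have [Uz|] := pselect (msupport FU z); last by right.
  left; exists (Num.truncn `|z|) => //; split.
    by apply: contrapT => /eqP az; apply: nex; exists z.
  by move=> j; rewrite (le_trans (coord_le_norm z j))// ltW// truncnS_gt.
move/(negligibleP _ measurableT) => /=; rewrite probability_setT => /eqP.
by rewrite onee_eq0.
Qed.

End hyperplanes.

(** * Independence and second moments *)

Section independence.
Context {dO : measure_display} {Omega : measurableType dO} {R : realType}.
Variables (P : probability Omega R) (n p : nat).
Variables (U : Omega -> 'rV[R]_n) (X : Omega -> 'rV[R]_p).
Hypotheses (mU : rand_vec U) (mX : rand_vec X).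

Local Notation L1 f := (P.-integrable setT (EFin \o f)).
Local Notation Ex f := (\int[P]_w f w)%R.

Lemma Ex_indic (A : set Omega) : measurable A -> Ex (\1_A) = fine (P A).
Proof.
move=> mA; rewrite /Rintegral; congr fine.
by have := integral_indic P measurableT mA; rewrite setIT => <-.
Qed.

Lemma mean_indepI : (forall i, L1 (fun w => X w 0 i)) ->
  (forall i, mean_indep_of P (U : Omega -> borelRV R n) (fun w => X w 0 i)) ->
  mean_indep P X U.
Proof.
move=> lX iX; split=> // A mA i; have mE := preimage_measurable mU mA.
have lXi := lX i; have := iX i A mA.
rewrite [X in _ = _ * X -> _](_ : _ = fine (P (U @^-1` A))); last exact: Ex_indic mE.
move=> E.
have l1 : L1 (fun w => X w 0 i * \1_(U @^-1` A) w).
  apply: (@L1_le _ _ _ _ _ (fun w => `|X w 0 i|)).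
  - by apply: measurable_funM; [exact: L1_measurable lXi|exact: measurable_indic].
  - by move=> w; rewrite normrM ler_piMr// indicE; case: (_ \in _); rewrite ?normr1 ?normr0.
  - exact: L1_norm.
rewrite integral_mkcond epatch_indic.
rewrite -[LHS]fineK; last by apply: integrable_fin_num => //; exact: l1.
rewrite -[X in (_ * X)%E]fineK; last exact: integrable_fin_num.
rewrite -[P _]fineK ?fin_num_measure// -EFinM; congr EFin.
by rewrite [RHS]mulrC; exact: E.
Qed.

(** The roles are exchanged: independence makes the indicator of an event of [U] mean independent of
    [X]. The bounded case applies to truncations of [phi], and [|phi(X)|] dominates the limit. *)
Lemma indep_mean_indep (phi : borelRV R p -> R) : indep_rv P U X ->
  measurable_fun setT phi -> L1 (fun w => phi (X w)) ->
  mean_indep_of P (U : Omega -> borelRV R n) (fun w => phi (X w)).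
Proof.
move=> iUX mphi lphi A mA; have mE := preimage_measurable mU mA.
pose W w : R := \1_A (U w).
have mW : measurable_fun setT W.
  by apply: (@measurable_indic _ _ _ setT (U @^-1` A)).
have W1 w : `|W w| <= 1 by rewrite /W indicE; case: (_ \in _); rewrite ?normr1 ?normr0.
have lW : L1 W by apply: (@L1_le _ _ _ _ _ (fun=> 1)) => //; exact: L1_cst.
have iW : mean_indep_of P (X : Omega -> borelRV R p) W.
  move=> C mC; have mF := preimage_measurable mX mC.
  rewrite (_ : Ex (fun w => \1_C (X w)) = fine (P (X @^-1` C))); last exact: Ex_indic mF.
  rewrite (_ : Ex W = fine (P (U @^-1` A))); last exact: Ex_indic mE.
  rewrite -fineM ?fin_num_measure// -iUX// -Ex_indic; last exact: measurableI.
  by apply: eq_Rintegral => w _; rewrite indicI.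
pose t k : borelRV R p -> R := fun x => phi x * \1_[set x | `|phi x| <= k%:R] x.
have mt k : measurable_fun setT (t k).
  apply: measurable_funM => //; apply: measurable_indic.
  rewrite (_ : [set x | _] = setT `&` (fun x => `|phi x|) @^-1` `]-oo, k%:R]); last first.
    by apply/seteqP; split=> x /=; rewrite in_itv /= ?setTI => //; case.
  have ma : measurable_fun setT (fun x => `|phi x|) by exact: measurableT_comp.
  exact: ma.
have tk k x : `|t k x| <= k%:R.
  rewrite /t indicE normrM; have [|_] := boolP (x \in _).
    by rewrite inE /= normr1 mulr1.
  by rewrite normr0 mulr0.
have tphi k x : `|t k x| <= `|phi x|.
  by rewrite normrM ler_piMr// indicE; case: (_ \in _); rewrite ?normr1 ?normr0.
have ct x : t k x @[k --> \oo] --> phi x.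
  apply: cvg_near_cst; exists (Num.truncn `|phi x|).+1 => // k /= kx.
  rewrite /t indicE mem_set ?mulr1//=; apply: le_trans (ltW (truncnS_gt _)) _.
  by rewrite ler_nat.
have mphiX := L1_measurable lphi.
have mtX k : measurable_fun setT (fun w => t k (X w)) by exact: measurableT_comp (mt k) mX.
have c1 : Ex (fun w => W w * t k (X w)) @[k --> \oo] --> Ex (fun w => W w * phi (X w)).
  apply: (@Ex_dominated _ _ _ _ _ _ (fun w => `|phi (X w)|)).
  - by move=> k; exact: measurable_funM.
  - exact: measurable_funM.
  - by move=> w; apply: cvgMr; exact: ct.
  - by move=> k w; rewrite normrM mulrC (le_trans _ (tphi k _))// ler_piMr.
  - exact: L1_norm.
have c2 : Ex W * Ex (fun w => t k (X w)) @[k --> \oo] --> Ex W * Ex (fun w => phi (X w)).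
  apply: cvgMr; apply: (@Ex_dominated _ _ _ _ _ _ (fun w => `|phi (X w)|)) => //.
  exact: L1_norm.
have E : (fun k => Ex (fun w => W w * t k (X w))) =
    (fun k => Ex W * Ex (fun w => t k (X w))).
  by apply/funext => k; exact: (mean_indep_bounded mX lW iW (mt k) (tk k)).
rewrite E in c1; have := cvg_unique _ c1 c2; rewrite [RHS]mulrC => <- //.
by apply: eq_Rintegral => w _; rewrite mulrC.
Qed.

End independence.

Section second_moments.
Context {dO : measure_display} {Omega : measurableType dO} {R : realType}.
Variables (P : probability Omega R) (p : nat) (X : Omega -> 'rV[R]_p).

Local Notation L1 f := (P.-integrable setT (EFin \o f)).
Local Notation Ex f := (\int[P]_w f w)%R.

Hypothesis mX : rand_vec X.
Hypothesis lXX : forall i j, L1 (fun w => X w 0 i * X w 0 j).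
Hypothesis rX : \rank (\matrix_(i < p, j < p) Ex (fun w => X w 0 i * X w 0 j)) = p.

(** If Xa = 0 almost surely, then E(X^T X) a = E(X^T X a) = 0, and the second moment matrix is
    invertible. *)
Lemma second_moment_inj (a : 'cV[R]_p) :
  {ae P, forall w, X w *m a = 0} -> a = 0.
Proof.
move=> Xa0; pose S := \matrix_(i < p, j < p) Ex (fun w => X w 0 i * X w 0 j).
have uS : S \in unitmx by rewrite -row_free_unit /row_free [\rank _]rX.
suff : S *m a = 0 by move=> Sa; rewrite -[a](mulKmx uS) Sa mulmx0.
apply/colP => i; rewrite !mxE.
have -> : \sum_j S i j * a j 0 = Ex (fun w => \sum_j a j 0 * (X w 0 i * X w 0 j)).
  rewrite Ex_sum; last by move=> j; exact: L1Z.
  by apply: eq_bigr => j _; rewrite ExZ// mxE mulrC.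
rewrite -[RHS](Ex_cst P 0); apply: Ex_ae.
- by apply: L1_measurable; apply: L1_sum => j; exact: L1Z.
- exact: measurable_cst.
apply: filterS Xa0 => w /colP/(_ 0); rewrite !mxE => Xa.
rewrite -[RHS](mulr0 (X w 0 i)) -[X in _ = _ * X]Xa mulr_sumr.
by apply: eq_bigr => j _; ring.
Qed.

Lemma sqr_mulmxE (a : 'cV[R]_p) w : (X w *m a) 0 0 ^+ 2 =
  \sum_i \sum_j (a i 0 * a j 0) * (X w 0 i * X w 0 j).
Proof.
rewrite expr2 mxE mulr_suml; apply: eq_bigr => i _; rewrite mulr_sumr.
by apply: eq_bigr => j _; ring.
Qed.

Lemma Ex_qform (a : 'cV[R]_p) :
  Ex (fun w => (X w *m a) 0 0 ^+ 2) =
  \sum_i \sum_j Ex (fun w => X w 0 i * X w 0 j) * (a i 0 * a j 0).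
Proof.
under eq_Rintegral do rewrite sqr_mulmxE.
have l2 i : L1 (fun w => \sum_j (a i 0 * a j 0) * (X w 0 i * X w 0 j)).
  by apply: L1_sum => j; exact: L1Z.
rewrite Ex_sum//; apply: eq_bigr => i _.
rewrite Ex_sum; last by move=> j; exact: L1Z.
by apply: eq_bigr => j _; rewrite ExZ// mulrC.
Qed.

(** The quadratic form is E((Xa)^2); its vanishing gives Xa = 0 almost surely. *)
Lemma Ex_qform_eq0 (a : 'cV[R]_p) :
  \sum_i \sum_j Ex (fun w => X w 0 i * X w 0 j) * (a i 0 * a j 0) = 0 -> a = 0.
Proof.
rewrite -Ex_qform => E0; apply: second_moment_inj.
have : {ae P, forall w, (X w *m a) 0 0 ^+ 2 = 0}.
  apply: Ex_ge0_eq0_ae E0; last by apply: aeW => w; exact: sqr_ge0.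
  under eq_fun do rewrite sqr_mulmxE.
  by apply: L1_sum => i; apply: L1_sum => j; exact: L1Z.
apply: filterS => w /eqP; rewrite sqrf_eq0 => /eqP Xa.
by apply/rowP => i; rewrite !ord1 Xa mxE.
Qed.

Variables (n : nat) (U : Omega -> 'rV[R]_n).
Hypotheses (mU : rand_vec U) (iUX : indep_rv P U X).

(** As [h k (U)] may fail to be integrable, the squared sum is integrated on each [trunc h N]. By
    independence its expectation is that of [q (U)], where [q] is the second moment form evaluated
    at [h], which vanishes only where all [h k] do. *)
Lemma indep_mulmx_eq0 (h : 'I_p -> borelRV R n -> R) :
  (forall k, measurable_fun setT (h k)) ->
  {ae P, forall w, \sum_k X w 0 k * h k (U w) = 0} ->
  {ae P, forall w k, h k (U w) = 0}.
Proof.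
move=> mh Xh0.
pose S i j := Ex (fun w => X w 0 i * X w 0 j).
pose q u := \sum_i \sum_j S i j * (h i u * h j u).
have q_ge0 u : 0 <= q u.
  have := Ex_qform (\col_k h k u).
  rewrite (_ : (\sum_i _) = q u); last first.
    by apply: eq_bigr => i _; apply: eq_bigr => j _; rewrite !mxE.
  by move=> <-; apply: Rintegral_ge0 => w _; exact: sqr_ge0.
have iXX i j : mean_indep_of P (U : Omega -> borelRV R n) (fun w => X w 0 i * X w 0 j).
  apply: (indep_mean_indep mU mX (phi := fun x => x 0 i * x 0 j)) => //.
  by apply: measurable_funM; exact: coord_borel.
have mt N : measurable (trunc h N : set (borelRV R n)) by exact: measurable_trunc.
have qN N : {ae P, forall w, q (U w) * \1_(trunc h N) (U w) = 0}.
  pose f i j u : R := h i u * h j u * \1_(trunc h N) u.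
  have mf i j : measurable_fun setT (f i j).
    by apply: measurable_funM; [exact: measurable_funM|exact: measurable_indic].
  have fN i j u : `|f i j u| <= N%:R * N%:R.
    rewrite /f indicE normrM; have [|_] := boolP (u \in trunc h N).
      by rewrite inE => ht; rewrite normr1 mulr1 normrM ler_pM.
    by rewrite normr0 mulr0 mulr_ge0.
  have lf i j : L1 (fun w => f i j (U w)) by exact: (L1_bounded_comp P mU (mf i j) (fN i j)).
  have lXf i j : L1 (fun w => X w 0 i * X w 0 j * f i j (U w)).
    exact: (L1_bounded mU (lXX i j) (mf i j) (fN i j)).
  have qE w : q (U w) * \1_(trunc h N) (U w) = \sum_i \sum_j S i j * f i j (U w).
    rewrite mulr_suml; apply: eq_bigr => i _; rewrite mulr_suml.
    by apply: eq_bigr => j _; rewrite -mulrA.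
  have lq : L1 (fun w => q (U w) * \1_(trunc h N) (U w)).
    by under eq_fun do rewrite qE; apply: L1_sum => i; apply: L1_sum => j; exact: L1Z.
  apply: Ex_ge0_eq0_ae lq _ _.
    by apply: aeW => w; rewrite mulr_ge0// indicE.
  under eq_Rintegral do rewrite qE.
  have -> : Ex (fun w => \sum_i \sum_j S i j * f i j (U w)) =
      Ex (fun w => \sum_i \sum_j X w 0 i * X w 0 j * f i j (U w)).
    rewrite !Ex_sum; [|by move=> i; apply: L1_sum|]; last first.
      by move=> i; apply: L1_sum => j; exact: L1Z.
    apply: eq_bigr => i _; rewrite !Ex_sum//; last by move=> j; exact: L1Z.
    apply: eq_bigr => j _; rewrite ExZ//.
    by rewrite (mean_indep_bounded mU (lXX i j) (iXX i j) (mf i j) (fN i j)).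
  rewrite -[RHS](Ex_cst P 0); apply: Ex_ae.
  - by apply: L1_measurable; apply: L1_sum => i; apply: L1_sum => j.
  - exact: measurable_cst.
  apply: filterS Xh0 => w Xh.
  transitivity ((\sum_k X w 0 k * h k (U w)) * (\sum_k X w 0 k * h k (U w)) *
      \1_(trunc h N) (U w)); last by rewrite Xh !mul0r.
  rewrite -mulrA mulr_suml; apply: eq_bigr => i _.
  rewrite mulr_suml mulr_sumr; apply: eq_bigr => j _; rewrite /f; ring.
have /ae_foralln : forall N, {ae P, forall w, q (U w) * \1_(trunc h N) (U w) = 0} := qN.
apply: filterS => w qw k.
have [N hN] := trunc_cover h (U w).
have := qw N; rewrite indicE mem_set// mulr1 => q0.
have /colP/(_ k) : \col_k h k (U w) = 0.
  apply: Ex_qform_eq0; rewrite -[RHS]q0 /q.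
  by apply: eq_bigr => i _; apply: eq_bigr => j _; rewrite !mxE.
by rewrite !mxE.
Qed.

End second_moments.

(** * Identification of the coefficients in the linear model *)

Lemma difference_quotient_cvg (R : realType) (n : nat) (f : 'rV[R]_n -> R)
    (u g h : 'rV[R]_n) : is_gradient f u g ->
  k.+1%:R * (f (u + k.+1%:R^-1 *: h) - f u) @[k --> \oo] --> dotv g h.
Proof.
move=> gf; apply/cvgrPdist_le => e e0.
have K0 : 0 < `|h| + 1 by rewrite ltr_wpDl.
have [r r0 rP] := is_gradient_frechet gf (divr_gt0 e0 K0).
have [m] := ltr_add_invr (divr_gt0 r0 K0); rewrite add0r ltr_pdivlMr// => mr.
exists m => // k /= mk.
have k0 : 0 < k.+1%:R :> R by [].
have nh : `|k.+1%:R^-1 *: h| = k.+1%:R^-1 * `|h|.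
  by rewrite normrZ ger0_norm// invr_ge0.
have /rP : `|k.+1%:R^-1 *: h| < r.
  rewrite nh; apply: le_lt_trans mr; apply: ler_pM => //.
  - by rewrite lef_pV2 ?posrE// ler_nat ltnS.
  - by rewrite lerDl.
rewrite nh dotvZr => H.
have -> : dotv g h - k.+1%:R * (f (u + k.+1%:R^-1 *: h) - f u) =
    - (k.+1%:R * (f (u + k.+1%:R^-1 *: h) - f u - k.+1%:R^-1 * dotv g h)).
  by rewrite [in RHS]mulrBr mulrA divff ?mul1r ?opprB// pnatr_eq0.
rewrite normrN normrM gtr0_norm// -ler_pdivlMl//; apply: le_trans H _.
rewrite mulrCA ler_pM2l ?invr_gt0// -mulrA ler_piMr ?(ltW e0)//.
by rewrite [_^-1 * _]mulrC ler_pdivrMr// mul1r lerDl.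
Qed.

Lemma continuous_borel (R : realType) (n m : nat) (f : 'rV[R]_n -> 'rV[R]_m) :
  continuous f -> measurable_fun setT (f : borelRV R n -> borelRV R m).
Proof.
move=> /continuousP cf; apply: (@measurability _ _ (borelRV R n) (borelRV R m) setT f (@open 'rV[R]_m)) => //.
by move=> _ [A oA <-]; rewrite setTI; apply: open_borel; exact: cf.
Qed.

Section coefficients.
Context {dO : measure_display} {Omega : measurableType dO} {R : realType}.
Variables (P : probability Omega R) (d p : nat).
Variables (FU : probability (borelRV R d) R) (X : Omega -> 'rV[R]_p).
Hypothesis mX : rand_vec X.
Hypothesis dFU : has_lebesgue_density FU.
Hypothesis cU : convex_set (msupport FU).
Hypothesis lXX : forall i j, P.-integrable setT (EFin \o (fun w => X w 0 i * X w 0 j)).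
Hypothesis rX :
  \rank (\matrix_(i < p, j < p) (\int[P]_w (X w 0 i * X w 0 j))%R) = p.
Variable U : Omega -> 'rV[R]_d.
Hypotheses (mU : rand_vec U) (lU : has_law P U FU) (iUX : indep_rv P U X).

(** [B] is continuous only within the support; by convexity, pulling [G] towards [z] stays there. *)
Lemma msupport_pull_borel (B : 'rV[R]_d -> 'rV[R]_p) (G : set 'rV[R]_d)
    (z : 'rV[R]_d) (t : R) (i : 'I_p) :
  {within msupport FU, continuous B} -> measurable (G : set (borelRV R d)) ->
  G `<=` msupport FU -> msupport FU z -> 0 <= t <= 1 ->
  measurable_fun (G : set (borelRV R d))
    (fun u : borelRV R d => B (u + t *: (z - u)) 0 i).
Proof.
move=> cB mG GU Uz t01.
have mBU : measurable_fun (msupport FU : set (borelRV R d))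
    (fun u : borelRV R d => B u 0 i).
  apply: within_continuous_borel.
    by apply: closed_borel; exact: closed_msupport.
  by move=> u; apply: (@continuous_comp (subspace (msupport FU)) _ _ B
    (fun v : 'rV[R]_p => v 0 i)); [exact: cB|exact: coord_continuous].
pose aff (u : 'rV[R]_d) := u + t *: (z - u).
have maff : measurable_fun setT (aff : borelRV R d -> borelRV R d).
  apply: continuous_borel => u; rewrite /continuous_at.
  apply: (@cvgD R 'rV[R]_d 'rV[R]_d (nbhs u) _ id (fun v => t *: (z - v))).
    exact: cvg_id.
  apply: (@cvgZl_tmp R 'rV[R]_d 'rV[R]_d (nbhs u) _ t (fun v => z - v)).
  apply: (@cvgB R 'rV[R]_d 'rV[R]_d (nbhs u) _ (fun=> z) id); first exact: cvg_cst.
  exact: cvg_id.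
have /= := @measurable_comp _ _ _ (borelRV R d) (borelRV R d) R (msupport FU)
  (fun u : borelRV R d => B u 0 i) G (aff : borelRV R d -> borelRV R d).
apply => //.
- by apply: closed_borel; exact: closed_msupport.
- move=> _ [u Gu <-]; have := convex_setP cU Uz (GU _ Gu) t01.
  by congr msupport; apply/rowP => j; rewrite /aff !mxE; ring.
- exact: measurable_funTS.
Qed.

(** No measurability of [beta] or [beta0] is assumed, so independence is applied to [H z], a limit
    of measurable difference quotients, rather than to [D]. *)
Lemma coefficient_unique (beta beta0 : 'rV[R]_d -> 'M[R]_(p, d))
    (B B0 : 'rV[R]_d -> 'rV[R]_p) :
  {within msupport FU, continuous B} -> {within msupport FU, continuous B0} ->
  (forall x, rv_support P X x ->
     leb_ae_in (msupport FU) (fun u => is_gradient (Phi B x) u (x *m beta u))) ->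
  (forall x, rv_support P X x ->
     leb_ae_in (msupport FU) (fun u => is_gradient (Phi B0 x) u (x *m beta0 u))) ->
  {ae P, forall w, X w *m beta (U w) = X w *m beta0 (U w)} ->
  {ae P, forall w, beta0 (U w) = beta (U w)}.
Proof.
move=> cB cB0 gB gB0 XE.
have [m [M [SM spM]]] := spanning_rows (rv_support P X).
have aeX := rv_support_ae P mX.
(* A column of [cokermx M] annihilates every support point of [X], hence is 0 by
   [second_moment_inj]; so the support spans the whole space. *)
have fM : row_full M.
  rewrite -sub1mx; apply/negPn/negP => nfM.
  have : cokermx M != 0 by apply: contra nfM => /eqP cM; rewrite submxE mul1mx cM.
  apply/negP; rewrite negbK; apply/eqP/matrixP => i j; rewrite mxE.
  have /colP/(_ i) : col j (cokermx M) = 0; last by rewrite !mxE.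
  apply: (second_moment_inj lXX rX); apply: filterS aeX => w /spM/submxP[c ->].
  by rewrite colE mulmxA -(mulmxA c) mulmx_coker mulmx0 mul0mx.
have NM : pinvmx M *m M = 1%:M by exact: mulVpmx.
have [|G1 [mG1 nG1 GU1 gG1]] := leb_ae_in_borel
  (Q := fun i u => is_gradient (Phi B (row i M)) u (row i M *m beta u)) dFU.
  by move=> i; exact/gB/SM.
have [|G2 [mG2 nG2 GU2 gG2]] := leb_ae_in_borel
  (Q := fun i u => is_gradient (Phi B0 (row i M)) u (row i M *m beta0 u)) dFU.
  by move=> i; exact/gB0/SM.
pose G := G1 `&` G2.
have mG : measurable (G : set (borelRV R d)) by exact: measurableI.
have nG : FU.-negligible (~` G) by rewrite setCI; exact: negligibleU.
have GU : G `<=` msupport FU by move=> u [/GU1].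
pose D u := beta u - beta0 u.
pose H z u : 'cV[R]_p := D u *m (z - u)^T.
have HP z : msupport FU z -> {ae P, forall w, H z (U w) = 0}.
  move=> Uz.
  pose Q (k : nat) (u : 'rV[R]_d) : 'rV[R]_p := k.+1%:R *:
    ((B (u + k.+1%:R^-1 *: (z - u)) - B u) - (B0 (u + k.+1%:R^-1 *: (z - u)) - B0 u)).
  have QM u i : G u -> (M *m (Q k u)^T) i 0 @[k --> \oo] --> (M *m H z u) i 0.
    move=> [G1u G2u].
    have -> : (M *m H z u) i 0 =
        dotv (row i M *m beta u) (z - u) - dotv (row i M *m beta0 u) (z - u).
      rewrite -dotvBl -mulmxBr dotvE -/(D u) -mulmxA.
      by rewrite -/(H z u) -row_mul [RHS]mxE.
    have -> : (fun k => (M *m (Q k u)^T) i 0) = (fun k =>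
      k.+1%:R * (Phi B (row i M) (u + k.+1%:R^-1 *: (z - u)) - Phi B (row i M) u) -
      k.+1%:R * (Phi B0 (row i M) (u + k.+1%:R^-1 *: (z - u)) - Phi B0 (row i M) u)).
      apply/funext => k; rewrite -mulrBr /Phi -!dotvBl -dotvZl dotvC dotvE.
      by rewrite mxE [RHS]mxE; apply: eq_bigr => j _; rewrite [row i M _ _]mxE.
    by apply: cvgB; apply: difference_quotient_cvg; [exact: gG1|exact: gG2].
  have QH u k : G u -> Q j u 0 k @[j --> \oo] --> H z u k 0.
    move=> Gu.
    have -> : H z u k 0 = \sum_i pinvmx M k i * (M *m H z u) i 0.
      by rewrite -[H z u in LHS]mul1mx -NM -mulmxA mxE.
    have -> : (fun j => Q j u 0 k) =
        (fun j => \sum_i pinvmx M k i * (M *m (Q j u)^T) i 0).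
      apply/funext => j; transitivity ((Q j u)^T k 0); first by rewrite [RHS]mxE.
      by rewrite -[(Q j u)^T in LHS]mul1mx -NM -mulmxA mxE.
    by apply: cvg_big => [|i _]; [exact: add_continuous|apply: cvgMr; exact: QM].
  have mQ j k : measurable_fun (G : set (borelRV R d)) (fun u : borelRV R d => Q j u 0 k).
    (* Writing [u] as [u + 0 *: (z - u)] lets [msupport_pull_borel] treat all four terms. *)
    rewrite (_ : (fun u => _) = fun u : borelRV R d => j.+1%:R *
      ((B (u + j.+1%:R^-1 *: (z - u)) 0 k - B (u + 0 *: (z - u)) 0 k) -
       (B0 (u + j.+1%:R^-1 *: (z - u)) 0 k - B0 (u + 0 *: (z - u)) 0 k))); last first.
      by apply/funext => u; rewrite !mxE !scale0r !addr0.
    have j01 : 0 <= (j.+1%:R^-1 : R) <= 1.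
      by rewrite invr_ge0 ler0n/= invf_le1// ler1n.
    have z01 : 0 <= (0 : R) <= 1 by rewrite lexx ler01.
    apply: measurable_funM; first exact: measurable_cst.
    by apply: measurable_funB; apply: measurable_funB; exact: msupport_pull_borel.
  have mH k : measurable_fun (G : set (borelRV R d)) (fun u : borelRV R d => H z u k 0).
    by apply: (measurable_fun_cvg (mQ ^~ k)) => u Gu; exact: QH.
  pose h k : borelRV R d -> R := (fun u => H z u k 0) \_ G.
  have mh k : measurable_fun setT (h k) by apply/(measurable_restrictT _ mG); exact: mH.
  have aeG := has_law_ae mU lU nG.
  have hE w k : G (U w) -> h k (U w) = H z (U w) k 0.
    by move=> Gw; rewrite /h patchE (mem_set Gw).
  have : {ae P, forall w, \sum_k X w 0 k * h k (U w) = 0}.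
    apply: filterS2 aeG XE => w Gw XEw.
    transitivity ((X w *m H z (U w)) 0 0).
      by rewrite [RHS]mxE; apply: eq_bigr => k _; rewrite hE.
    by rewrite /H mulmxA /D mulmxBr XEw subrr mul0mx mxE.
  move/(indep_mulmx_eq0 mX lXX rX mU iUX mh).
  apply: filterS2 aeG => w Gw hw; apply/colP => k.
  by rewrite -hE// hw mxE.
have [z0 Uz0] : exists z0, msupport FU z0.
  apply: contrapT => /forallNP U0.
  have : FU.-negligible setT.
    by apply: negligibleS (msupport_compl_negligible FU) => u _; exact: U0.
  by move/(negligibleP _ measurableT) => /=; rewrite probability_setT => /eqP; rewrite onee_eq0.
(* Finitely many differences span all [z - z0], so only finitely many null events are discarded. *)
have [r [N [SN spN]]] := spanning_rows [set y | exists2 z, msupport FU z & y = z - z0].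
have /choice[z zP] : forall i, exists z, msupport FU z /\ row i N = z - z0.
  by move=> i; have [z] := SN i; exists z.
have aez : {ae P, forall w i, H (z i) (U w) = 0}.
  by apply: filter_forall => i; exact: HP _ (zP i).1.
apply: filterS2 aez (HP _ Uz0) => w Hz Hz0.
suff D0 : D (U w) = 0 by apply/esym/eqP; rewrite -subr_eq0 -/(D (U w)) D0.
have DN : D (U w) *m N^T = 0.
  apply/matrixP => i j; have /colP/(_ i) := Hz j; have /colP/(_ i) := Hz0.
  move=> e0 ej.
  transitivity ((D (U w) *m (row j N)^T) i 0).
    by rewrite !mxE; apply: eq_bigr => k _; rewrite !mxE.
  rewrite (zP j).2 (_ : z j - z0 = (z j - U w) - (z0 - U w)); last by rewrite opprB addrA subrK.
  by rewrite linearB/= mulmxBr mxE [X in _ + X]mxE -!/(H _ _) e0 ej !mxE subrr.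
(* A nonzero row of [D (U w)] would be orthogonal to every [y - z0], placing the support in a
   hyperplane. *)
apply/row_matrixP => i; rewrite row0; apply/eqP/negPn/negP => ai0.
have [y Uy] := msupport_off_hyperplane (dotv (row i (D (U w))) z0) dFU ai0.
apply/negP; rewrite negbK -subr_eq0 -dotvBr; apply/eqP.
have /submxP[c ->] : (y - z0 <= N)%MS by apply: spN; exists y.
by rewrite dotvE trmx_mul mulmxA -row_mul DN row0 mul0mx mxE.
Qed.

End coefficients.

(** * Optimality, uniqueness and the linear model combined *)

Unset Implicit Arguments.
Set Strict Implicit.
Set Printing Implicit Defensive.

Theorem theorem3p1 (R : realType) (dO : measure_display)
  (Omega : measurableType dO) (P : probability Omega R)
  (d k p : nat) (hp : (0 < p)%N)
  (Y : Omega -> 'rV[R]_d) (Z : Omega -> 'rV[R]_k)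
  (f : 'rV[R]_k -> 'rV[R]_p) (X : Omega -> 'rV[R]_p)
  (FU : probability (borelRV R d) R)
  (Ut : Omega -> 'rV[R]_d) (beta : 'rV[R]_d -> 'M[R]_(p, d))
  (B : 'rV[R]_d -> 'rV[R]_p) :
  (* setting *)
  rand_vec Y -> rand_vec Z ->
  measurable_fun setT (f : borelRV R k -> borelRV R p) ->
  (forall z, f z 0 (Ordinal hp) = 1) ->
  (forall w, X w = f (Z w)) ->
  sigma_sub Z X ->
  has_lebesgue_density FU ->
  convex_set (msupport FU) ->
  (* (M) *)
  (\int[P]_w (sqnorm (Y w))%:E < +oo)%E ->
  (\int[FU]_u (sqnorm u)%:E < +oo)%E ->
  (* (C) *)
  cond_law_has_density P Y Z ->
  (* (QL) *)
  rand_vec Ut -> has_law P Ut FU -> mean_indep P X Ut ->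
  {ae P, forall w, Y w = X w *m beta (Ut w)} ->
  (forall x, rv_support P X x ->
     leb_ae_in (msupport FU) (fun u => is_gradient (Phi B x) u (x *m beta u))) ->
  C1_on (msupport FU) B ->
  (forall x, rv_support P X x -> strictly_convex_on (msupport FU) (Phi B x)) ->
  [/\
  (* (i) *)
   solves_max P FU X Y Ut,
  (* (ii) *)
   (forall (Ub : Omega -> 'rV[R]_d) (betab : 'rV[R]_d -> 'M[R]_(p, d)),
     rand_vec Ub -> has_law P Ub FU -> mean_indep P X Ub ->
     {ae P, forall w, Y w = X w *m betab (Ub w)} ->
     {ae P, forall w, exists phi : 'rV[R]_d -> R,
        strictly_convex_on (msupport FU) phi /\
        leb_ae_in (msupport FU) (fun u => is_gradient phi u (X w *m betab u))} ->
     {ae P, forall w, Ub w = Ut w /\ X w *m beta (Ut w) = X w *m betab (Ut w)}) &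
  (* (iii) *)
   (forall (U : Omega -> 'rV[R]_d) (beta0 : 'rV[R]_d -> 'M[R]_(p, d))
           (B0 : 'rV[R]_d -> 'rV[R]_p),
     rand_vec U -> has_law P U FU -> indep_rv P U X ->
     {ae P, forall w, Y w = X w *m beta0 (U w)} ->
     (forall u x, msupport FU u -> rv_support P X x ->
        is_gradient (Phi B0 x) u (x *m beta0 u)) ->
     C1_on (msupport FU) B0 ->
     (forall x, rv_support P X x -> strictly_convex_on (msupport FU) (Phi B0 x)) ->
     (forall i j, P.-integrable setT (fun w => (X w 0 i * X w 0 j)%:E)) ->
     \rank (\matrix_(i < p, j < p) fine (\int[P]_w (X w 0 i * X w 0 j)%:E)%E)
       = p ->
     [/\ {ae P, forall w, Ut w = U w},
         solves_max P FU X Y U &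
         {ae P, forall w, beta0 (U w) = beta (U w)}])].
Proof.
move=> mY mZ mf _ XE _ dFU cU Y2 U2 _ mUt lUt iUt YE gB [cB _] scB.
have mX : rand_vec X.
  by rewrite (_ : X = f \o Z); [exact: (measurableT_comp mf mZ)|exact/funext].
have fUt : feasible P FU X Ut by [].
have aeX := rv_support_ae P mX.
have optUt := linear_potential_optimal mY mX dFU cU Y2 U2 fUt YE gB cB scB.
have uniq (Ub : Omega -> 'rV[R]_d) (betab : 'rV[R]_d -> 'M[R]_(p, d)) :
    feasible P FU X Ub -> {ae P, forall w, Y w = X w *m betab (Ub w)} ->
    {ae P, forall w, exists phi : 'rV[R]_d -> R,
      strictly_convex_on (msupport FU) phi /\
      leb_ae_in (msupport FU) (fun u => is_gradient phi u (X w *m betab u))} ->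
    {ae P, forall w, Ub w = Ut w /\ X w *m beta (Ut w) = X w *m betab (Ut w)}.
  move=> fUb YbE gphi.
  (* [Ub] does at least as well as [Ut], so the uniqueness clause of [optUt] applies to it. *)
  have leUb := convex_potential_optimal mY dFU cU Y2 U2 fUb YbE gphi fUt.
  have UbUt := (optUt _ fUb).2 leUb.
  apply: filterS3 UbUt YE YbE => w UbUtw YEw YbEw; split=> //.
  by rewrite -YEw YbEw UbUtw.
split.
- by split=> // V /optUt[].
- by move=> Ub betab mUb lUb iUb; exact: uniq.
move=> U beta0 B0 mU lU iUX YE0 gB0 [cB0 _] scB0 lXX rX.
have lX := iUt.1.
have fU : feasible P FU X U.
  split=> //; split=> //; apply: mean_indepI => // i.
  exact: (indep_mean_indep mU mX (phi := fun x => x 0 i) iUX (@coord_borel R p i) (lX i)).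
have aeB0 x : rv_support P X x ->
    leb_ae_in (msupport FU) (fun u => is_gradient (Phi B0 x) u (x *m beta0 u)).
  (* The null set of [gB] is reused as witness: for [d = 0] every box has volume 1, and even the
     empty set is not [lebesgue_null]. *)
  by move=> Sx; have [N [nN _]] := gB x Sx; exists N; split=> // u Uu _; exact: gB0.
have gphi : {ae P, forall w, exists phi : 'rV[R]_d -> R,
    strictly_convex_on (msupport FU) phi /\
    leb_ae_in (msupport FU) (fun u => is_gradient phi u (X w *m beta0 u))}.
  by apply: filterS aeX => w Sw; exists (Phi B0 (X w)); split; [exact: scB0|exact: aeB0].
(* The linear model is itself a second representation, with potentials [Phi B0 (X w)]. *)
have UE := uniq U beta0 fU YE0 gphi.
split.
- by apply: filterS UE => w [->].
- by split=> //; exact: (convex_potential_optimal mY dFU cU Y2 U2 fU YE0 gphi).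
- apply: (coefficient_unique mX dFU cU lXX rX mU lU iUX cB cB0 gB aeB0).
  by apply: filterS UE => w [-> ->].
Qed.
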